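(* For any $\eta\in(0,\tfrac12]$ there exists a constant $K<\infty$ for which the following holds. Let $A,B$ be Lebesgue measurable subsets of $\mathbb{R}^1$ with finite, positive Lebesgue measures satisfying $$\min(|A|,|B|)\ge\eta(1-\eta)^{-1}\max(|A|,|B|).$$ Let $\tau\in[\,\eta\max(|A|,|B|),\,(1-\eta)\min(|A|,|B|)\,]$. If the deficit $$\mathcal{D}'=\mathcal{D}'(A,B,\tau) = \Big[|A|\cdot|B|-\tau(|A|+|B|) +\tau^2\Big] - \int_\tau^\infty |S_{A,B}(t)|\,dt$$ satisfies $$\mathcal{D}' <\min\big(\tau^2,\,(|B|-\tau)^2,\,K^{-1}\eta^8\max(|A|,|B|)^2\big),$$ then there exist intervals $I,J\subset\mathbb{R}$ satisfying $|A\bigtriangleup I|\le K\sqrt{\mathcal{D}'}$ and $|B\bigtriangleup J|\le K\sqrt{\mathcal{D}'}$.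
   Context: $|A|$ denotes Lebesgue measure of $A\subset\mathbb{R}$, $\mathbf{1}_A$ the indicator function of $A$, $*$ is convolution on $\mathbb{R}$, and $S\bigtriangleup T$ is the symmetric difference. For measurable $A,B\subset\mathbb{R}^1$ of finite measure, $\mathbf{1}_A*\mathbf{1}_B$ is a continuous function and $S_{A,B}(t)=\{x\in\mathbb{R}: (\mathbf{1}_A*\mathbf{1}_B)(x)>t\}$. (The KPRGT inequality on $\mathbb{R}^1$ states that $\mathcal{D}'(A,B,\tau)\ge 0$ for $0\le\tau\le\min(|A|,|B|)$.) *)

(* Defs.v *)
From mathcomp Require Import all_boot all_order all_algebra.
From mathcomp Require Import all_classical all_reals all_analysis.

Set Implicit Arguments.
Unset Strict Implicit.
Unset Printing Implicit Defensive.
Import Order.TTheory GRing.Theory Num.Theory.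
Import numFieldNormedType.Exports.

Local Open Scope classical_set_scope.
Local Open Scope ring_scope.

(* MathComp-Analysis equips [R : realType] with its Borel sigma-algebra.
   Lebesgue measurable sets are the Caratheodory measurable sets of the outer
   measure induced by interval length, i.e. the domain of
   [completed_lebesgue_measure]; all integrals below are with respect to that
   complete measure. *)
Definition lebesgue_measurable (R : realType) (A : set R) : Prop :=
  ((@wlength R idfun)^*)%mu.-cara.-measurable A.

Definition vol (R : realType) (A : set R) : \bar R :=
  completed_lebesgue_measure A.

(* Real-valued volume, to be used for sets of finite measure only
   ([fine +oo = 0]). *)
Definition rvol (R : realType) (A : set R) : R := fine (vol A).

Definition convolution (R : realType) (f g : R -> R) (x : R) : R :=
  \int[@completed_lebesgue_measure R]_y (f y * g (x - y)).

Definition superlevel (R : realType) (A B : set R) (t : R) : set R :=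
  [set x | t < convolution \1_A \1_B x].

(* For [A], [B] of finite measure and [0 <= tau] the integral is at most
   [rvol A * rvol B], so [fine] loses nothing. *)
Definition deficit (R : realType) (A B : set R) (tau : R) : R :=
  (rvol A * rvol B - tau * (rvol A + rvol B) + tau ^+ 2)
  - fine (\int[@completed_lebesgue_measure R]_(t in `[tau, +oo[)
            vol (superlevel A B t))%E.

(* Main.v *)
Require Import Defs.
From HB Require Import structures.
From mathcomp Require Import all_boot all_order all_algebra.
From mathcomp Require Import all_classical all_reals all_analysis.
From mathcomp Require Import measurable_realfun zify lra ring.

Set Implicit Arguments.
Unset Strict Implicit.
Unset Printing Implicit Defensive.
Import Order.TTheory GRing.Theory Num.Theory.
Import numFieldNormedType.Exports.

Local Open Scope classical_set_scope.
Local Open Scope ring_scope.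

(** The deficit is nonnegative, and small only near intervals, for a combinatorial
    reason that is cleanest for finite sets [X], [Y] of integers, with [rep z]
    the number of representations [z = x + y].  In the rectangle [X * Y], ordered
    by ranks, the pairs with a given value of min (rank of [x] from below, rank
    of [y] from above) form an increasing chain, so their sums are distinct.  Hence
    a sum has at most [t] representations by pairs with key below [t], and the
    total excess of [rep] over [t] is at most the number (|X| - t) (|Y| - t) of
    the remaining pairs.  This is Pollard's inequality ([pollard]).  The
    slack of this argument shows more ([bad_pairs]): if the deficit is at most
    [E ^ 2], then all but [E ^ 2] of the sums of the upper [|X| - t]
    elements of [X] and the lower [|Y| - t] elements of [Y] are popular, that is,
    have more than [t] representations; and the inequality at the levels
    [t - E] and [t + E] shows that there are (|X| - t) + (|Y| - t) popular sums
    up to O(E) ([popular_upper], [popular_lower]).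

    So two sets A, B have at most |A| + |B| + O(E) relevant sums, and
    [sumset_stability] must make A an interval up to O(E).  The sums along a
    row [x + B], continued along an extreme column on either side, already
    exhaust the popular sums.  Comparing two rows, [B] is invariant up to O(E) under
    the difference of their abscissae; by symmetry [A] is invariant under
    differences of elements of [B].  Therefore a shift [h] which is a difference
    of elements of [A] at all is a difference of very many pairs.  If [A] has few
    left endpoints of runs, then also [h + 1] is a difference, and inductively
    all shifts up to a large multiple of [E] nearly preserve [A]
    ([all_shifts]).  A set with this property has O(E) holes ([drift_holes]).
    The condition on the endpoints excludes arithmetic progressions with larger
    steps and holds for sets that come from a fine discretization of the line.

    This controls the elements of [X] with rank at least [t] from one of the two
    ends, hence all of [X] if [t < |X| / 2].  If [t] is larger, then
    one uses that near maximality of the number of triples [x + y = z], with [z]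
    popular, is symmetric in the three sets: for [X] and the negatives of the
    popular sums the level is [|X| - t] ([dual_deficit]).  In the limiting case
    [t = |X| / 2], the level can be moved by O(E), because the deficit depends on it
    quadratically with a nearly stationary point ([shift_level]).  Together:
    [pollard_stability].

    On the line, [A] and [B] are squeezed between compact and open sets and
    replaced by the cells of a grid of mesh [1 / N] ([discretize]); the integral of
    the measures of the superlevel sets is at most the discrete excess divided
    by [N ^ 2], at a slightly lower level ([convolution_le],
    [superlevel_integral_le]).  The discrete theorem is applied with [E / N] close
    to the square root of the deficit.  If the deficit is zero, this yields
    intervals with arbitrarily small error, and a lower limit of them is an exact
    solution ([interval_limit]). *)

(** * Counting in lists *)

Lemma count_inj (T U : eqType) (f : T -> U) (s : seq T) (u : seq U)
    (P : pred T) (Q : pred U) : uniq s ->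
  (forall x y, x \in s -> y \in s -> P x -> P y -> f x = f y -> x = y) ->
  (forall x, x \in s -> P x -> (f x \in u) && Q (f x)) ->
  (count P s <= count Q u)%N.
Proof.
move=> us fI fQ; rewrite -!size_filter -(size_map f); apply: uniq_leq_size.
  rewrite map_inj_in_uniq ?filter_uniq // => x y.
  by rewrite !mem_filter => /andP[Px xs] /andP[Py ys]; apply: fI.
move=> _ /mapP[x + ->]; rewrite !mem_filter => /andP[Px xs].
by have /andP[-> ->] := fQ x xs Px.
Qed.

Lemma count_imply (T : eqType) (s : seq T) (P Q : pred T) :
  (forall x, x \in s -> P x -> Q x) -> (count P s <= count Q s)%N.
Proof.
move=> PQ; rewrite -(@eq_in_count _ (fun x => P x && Q x)).
  by apply: sub_count => x /= /andP[].
by move=> x xs; apply: andb_idr => Px; apply: PQ.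
Qed.

Lemma count_split (T : eqType) (s : seq T) (P Q S : pred T) :
  (forall x, x \in s -> P x -> Q x || S x) ->
  (count P s <= count Q s + count S s)%N.
Proof.
move=> PQS; apply: leq_trans (count_imply PQS) _.
by rewrite -count_predUI leq_addr.
Qed.

Lemma count_exists (T : eqType) (s : seq T) (P Q : pred T) :
  (count Q s < count P s)%N -> exists x, [/\ x \in s, P x & ~~ Q x].
Proof.
move=> lt; case: (@hasP _ (fun x => P x && ~~ Q x) s) => [[x xs /andP[]]|nh].
  by exists x.
suff : (count P s <= count Q s)%N by rewrite leqNgt lt.
apply: count_imply => x xs Px; apply/negPn/negP => nQ.
by apply: nh; exists x; rewrite ?Px.
Qed.

Lemma count_ltn (T : eqType) (s : seq T) (P Q : pred T) x :
  (forall x, x \in s -> P x -> Q x) -> x \in s -> Q x -> ~~ P x ->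
  (count P s < count Q s)%N.
Proof.
move=> PQ xs Qx nPx.
apply: (@leq_trans (count (predU P (pred1 x)) s)); last first.
  by apply: count_imply => y ys /= /orP[/(PQ _ ys) //|/eqP->].
have := count_predUI P (pred1 x) s.
rewrite (@eq_count _ (predI P (pred1 x)) pred0); last first.
  by move=> y /=; case: eqP => [->|]; rewrite ?andbF // (negbTE nPx).
have : (0 < count_mem x s)%N by rewrite -has_count has_pred1.
rewrite count_pred0; lia.
Qed.

Lemma markov_sum (T : eqType) (s : seq T) (F : T -> nat) (P : pred T) k :
  (forall x, x \in s -> P x -> k <= F x)%N ->
  (count P s * k <= \sum_(x <- s) F x)%N.
Proof.
move=> kF; rewrite -sum1_count big_distrl /= [leqRHS](bigID P) /=.
apply: leq_trans (leq_addr _ _).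
rewrite big_seq_cond [leqRHS]big_seq_cond; apply: leq_sum => x /andP[xs Px]; rewrite mul1n.
exact: kF.
Qed.

Lemma sum_count_exchange (T U : Type) (s : seq T) (u : seq U)
    (P : T -> U -> bool) :
  (\sum_(x <- s) count (P x) u = \sum_(y <- u) count (P^~ y) s)%N.
Proof.
under eq_bigr do rewrite -sum1_count big_mkcond.
rewrite exchange_big /=; apply: eq_bigr => y _.
by rewrite -sum1_count [RHS]big_mkcond.
Qed.

(** * Ranks and Pollard's inequality *)

Definition below (X : seq int) (x : int) := count (fun y => y < x) X.
Definition above (X : seq int) (x : int) := count (fun y => x < y) X.
Definition negs (X : seq int) := [seq - x | x <- X].

Lemma mem_negs (X : seq int) z : (z \in negs X) = (- z \in X).
Proof.
by rewrite -{1}(opprK z) mem_map //; apply: oppr_inj.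
Qed.

Lemma uniq_negs (X : seq int) : uniq (negs X) = uniq X.
Proof. by rewrite map_inj_uniq //; apply: oppr_inj. Qed.

Lemma count_negs (X : seq int) P : count P (negs X) = count (fun x => P (- x)) X.
Proof. by rewrite count_map. Qed.

Lemma above_negs (X : seq int) x : above X x = below (negs X) (- x).
Proof. by rewrite /below count_negs; apply: eq_count => y; lia. Qed.

Lemma below_lt (X : seq int) x y : x \in X -> x < y -> (below X x < below X y)%N.
Proof. by move=> xX xy; apply: (@count_ltn _ _ _ _ x) => // [z _|]; lia. Qed.

Lemma above_mono (X : seq int) x y : x <= y -> (above X y <= above X x)%N.
Proof. by move=> xy; apply: count_imply => z _; lia. Qed.

Lemma above_lt (X : seq int) x y : y \in X -> x < y -> (above X y < above X x)%N.
Proof. by move=> xX xy; apply: (@count_ltn _ _ _ _ y) => // [z _|]; lia. Qed.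

Lemma below_uniq (X : seq int) : uniq X -> perm_eq [seq below X x | x <- X] (iota 0 (size X)).
Proof.
move=> uX; have pX : perm_eq X (sort <=%O X) by rewrite perm_sym perm_sort.
have sX : sorted <%O (sort <=%O X) by rewrite sort_lt_sorted.
rewrite (permPl (perm_map _ pX)).
rewrite (@eq_map _ _ _ (below (sort <=%O X))) => [|x]; last exact/permP.
suff -> : [seq below (sort <=%O X) x | x <- sort <=%O X] = iota 0 (size X) by [].
apply: (@eq_from_nth _ 0%N) => [|i]; rewrite size_map size_sort ?size_iota // => iX.
rewrite (nth_map 0) ?size_sort // nth_iota // add0n /below.
by apply: count_lt_nth; rewrite ?size_sort.
Qed.

Lemma count_below (X : seq int) (P : pred nat) : uniq X ->
  count (fun x => P (below X x)) X = count P (iota 0 (size X)).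
Proof.
move=> uX; rewrite -(permP (below_uniq uX)) count_map; exact: eq_count.
Qed.

Lemma count_iota_lt s m : count (fun i => (i < s)%N) (iota 0 m) = minn s m.
Proof.
elim: m => [|m IH]; first by rewrite minn0.
rewrite -addn1 iotaD count_cat IH /= add0n; lia.
Qed.

Lemma count_below_lt (X : seq int) s : uniq X ->
  count (fun x => below X x < s)%N X = minn s (size X).
Proof. by move=> uX; rewrite (count_below (fun i => i < s)%N uX) count_iota_lt. Qed.

Lemma count_below_ge (X : seq int) s : uniq X ->
  count (fun x => s <= below X x)%N X = (size X - s)%N.
Proof.
move=> uX; have := count_predC (fun x => below X x < s)%N X.
rewrite count_below_lt // (@eq_count _ (predC _) (fun x => s <= below X x)%N).
  by lia.
by move=> x /=; rewrite -leqNgt.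
Qed.

Lemma above_count (X : seq int) (P : pred nat) : uniq X ->
  count (fun x => P (above X x)) X = count (fun x => P (below (negs X) x)) (negs X).
Proof. by move=> uX; rewrite count_negs; apply: eq_count => x; rewrite above_negs. Qed.

Lemma size_negs (X : seq int) : size (negs X) = size X. Proof. exact: size_map. Qed.

Lemma count_above_lt (X : seq int) s : uniq X ->
  count (fun x => above X x < s)%N X = minn s (size X).
Proof.
move=> uX; rewrite (above_count (fun i => i < s)%N) // count_below_lt ?uniq_negs //.
by rewrite size_negs.
Qed.

Lemma count_above_ge (X : seq int) s : uniq X ->
  count (fun x => s <= above X x)%N X = (size X - s)%N.
Proof.
move=> uX; rewrite (above_count (fun i => s <= i)%N) // count_below_ge ?uniq_negs //.
by rewrite size_negs.
Qed.

Lemma below_above (X : seq int) x : uniq X -> x \in X ->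
  (below X x + above X x).+1 = size X.
Proof.
move=> uX xX; rewrite -(count_predC (fun y => y < x) X) -addnS; congr addn.
transitivity (count (predU (pred1 x) (fun y => x < y)) X); last first.
  by apply: eq_count => y /=; lia.
have := count_predUI (pred1 x) (fun y => x < y) X.
rewrite [X in (_ + X)%N](@eq_count _ _ pred0) => [|y /=]; last by lia.
by rewrite count_pred0 addn0 => ->; rewrite (count_uniq_mem x uX) xX.
Qed.

(** The discrete convolution of two indicator functions. *)
Definition rep (X Y : seq int) (z : int) := count (fun x => z - x \in Y) X.
Definition sumset (X Y : seq int) := undup [seq x + y | x <- X, y <- Y].
(** The counterpart of the integral of the measures of the superlevel sets
    above the level [t], by the layer-cake formula. *)
Definition excess (X Y : seq int) (t : nat) :=
  (\sum_(z <- sumset X Y) (rep X Y z - t))%N.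
(** The counterpart of a superlevel set. *)
Definition popular (X Y : seq int) (t : nat) :=
  [seq z <- sumset X Y | (t < rep X Y z)%N].

Lemma uniq_popular (X Y : seq int) t : uniq (popular X Y t).
Proof. by rewrite filter_uniq ?undup_uniq. Qed.

Lemma mem_popular (X Y : seq int) t z : (z \in popular X Y t) = (t < rep X Y z)%N.
Proof.
rewrite mem_filter andb_idr // => tz.
have /hasP[x xX yY] : has (fun x => z - x \in Y) X by rewrite has_count; apply: leq_ltn_trans tz.
by rewrite mem_undup; apply/allpairsP; exists (x, z - x); rewrite /= xX yY; split=> //; ring.
Qed.

(** On a fibre of the addition map the smaller of [below X x] and [above Y y]
    determines the point: moving along the fibre, [x] increases while [y]
    decreases, so both numbers strictly increase. *)
Lemma chain_key_inj (X Y : seq int) z x x' :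
  x \in X -> x' \in X -> z - x \in Y -> z - x' \in Y ->
  minn (below X x) (above Y (z - x)) = minn (below X x') (above Y (z - x')) ->
  x = x'.
Proof.
move=> xX x'X yY y'Y; case: (ltgtP x x') => // lt e.
  have := below_lt xX lt; have : (above Y (z - x) < above Y (z - x'))%N.
    by apply: above_lt => //; lia.
  lia.
have := below_lt x'X lt; have : (above Y (z - x') < above Y (z - x))%N.
  by apply: above_lt => //; lia.
lia.
Qed.

(** At most [t] points of a fibre have a key below [t], since the keys are
    distinct. *)
Lemma rep_le_chains (X Y : seq int) t z : uniq X ->
  (rep X Y z <= t + count (fun x => [&& (z - x)%R \in Y, t <= below X x
                                     & t <= above Y (z - x)%R]) X)%N.
Proof.
move=> uX; rewrite -{1}(size_iota 0 t) -(count_predT (iota 0 t)).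
pose lowkey x := (z - x \in Y) && (minn (below X x) (above Y (z - x)) < t)%N.
apply: (@leq_trans (count lowkey X + count (fun x => [&& (z - x)%R \in Y,
    t <= below X x & t <= above Y (z - x)%R]) X)%N).
  by apply: count_split => x xX yY; rewrite /lowkey yY /=; lia.
rewrite leq_add2r; apply: (@count_inj _ _ (fun x => minn (below X x) (above Y (z - x)))) => //.
  move=> x x' xX x'X /andP[yY _] /andP[y'Y _]; exact: chain_key_inj.
by move=> x xX /andP[_ lt]; rewrite mem_iota leq0n add0n lt.
Qed.

Lemma excess_le_chains (X Y : seq int) t : uniq X -> uniq Y ->
  (excess X Y t <= \sum_(x <- X | (t <= below X x)%N)
     count (fun y => (t <= above Y y)%N && ((x + y)%R \in popular X Y t)) Y)%N.
Proof.
move=> uX uY.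
pose P (z x : int) := [&& (t < rep X Y z)%N, z - x \in Y, (t <= below X x)%N
                & (t <= above Y (z - x))%N].
apply: (@leq_trans (\sum_(z <- sumset X Y) count (P z) X)).
  apply: leq_sum => z _; rewrite /P; case: ltnP => [_|]; last first.
    by rewrite -subn_eq0 => /eqP->.
  by rewrite leq_subLR; apply: rep_le_chains.
rewrite sum_count_exchange [leqRHS]big_mkcond /=; apply: leq_sum => x _.
case: (leqP t (below X x)) => tx; last first.
  by rewrite (@eq_count _ _ pred0) ?count_pred0 // => z; rewrite /P (leqNgt t) tx !andbF.
apply: (@count_inj _ _ (fun z => z - x)); first exact: undup_uniq.
  by move=> z z' _ _ _ _; lia.
move=> z _ /and4P[h1 h2 h3 h4]; rewrite h2 h4 mem_popular.
by have -> : x + (z - x) = z by ring.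
Qed.

Lemma sum_count_const (T U : Type) (s : seq T) (P : pred T) (u : seq U) (Q : pred U) :
  (\sum_(x <- s | P x) count Q u = count P s * count Q u)%N.
Proof. by rewrite big_const_seq iter_addn_0 mulnC. Qed.

(** The integer version of Pollard's inequality: the whole excess is carried by
    the pairs with key at least [t], which form a product set. *)
Lemma pollard (X Y : seq int) t : uniq X -> uniq Y ->
  (excess X Y t <= (size X - t) * (size Y - t))%N.
Proof.
move=> uX uY; apply: leq_trans (excess_le_chains t uX uY) _.
rewrite -(count_below_ge t uX) -(count_above_ge t uY) -sum_count_const.
by apply: leq_sum => x _; apply: count_imply => y _ /andP[].
Qed.

(** The argument for [pollard] wastes each pair with key at least [t] and an
    unpopular sum, so such pairs are few if the inequality is nearly sharp. *)
Lemma bad_pairs (X Y : seq int) t : uniq X -> uniq Y ->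
  (excess X Y t + \sum_(x <- X | (t <= below X x)%N)
     count (fun y => (t <= above Y y)%N && ((x + y)%R \notin popular X Y t)) Y
   <= (size X - t) * (size Y - t))%N.
Proof.
move=> uX uY; apply: leq_trans (leq_add (excess_le_chains t uX uY) (leqnn _)) _.
rewrite -(count_below_ge t uX) -(count_above_ge t uY) -sum_count_const -big_split /=.
apply: leq_sum => x _; rewrite -count_predUI [X in (_ + X)%N](@eq_count _ _ pred0).
  by rewrite count_pred0 addn0; apply: count_imply => y _ /orP[]/andP[].
by move=> y /=; case: (_ \in _); rewrite ?andbF.
Qed.
(** * The popular set: size, change of level, duality *)

Lemma size_popular (X Y : seq int) t :
  size (popular X Y t) = count (fun z => t < rep X Y z)%N (sumset X Y).
Proof. by rewrite size_filter. Qed.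

Lemma excess_popular_le (X Y : seq int) t e : (e <= t)%N ->
  (excess X Y t + e * size (popular X Y t) <= excess X Y (t - e))%N.
Proof.
move=> et; rewrite size_popular -sum1_count big_distrr /= [X in (_ + X)%N]big_mkcond -big_split /=.
by apply: leq_sum => z _; case: ltnP => h; lia.
Qed.

Lemma excess_popular_ge (X Y : seq int) t e :
  (excess X Y t <= excess X Y (t + e) + e * size (popular X Y t))%N.
Proof.
rewrite size_popular -sum1_count big_distrr /= [X in (_ + X)%N]big_mkcond -big_split /=.
by apply: leq_sum => z _; case: ltnP => h; lia.
Qed.

(** Each popular sum contributes [E] more to the excess at the level [t - E] than
    at [t], and the former is bounded by Pollard's inequality. *)
Lemma popular_upper (X Y : seq int) t E : uniq X -> uniq Y ->
  ((size X - t) * (size Y - t) <= excess X Y t + E * E)%N ->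
  (0 < E <= t)%N -> (t <= size X)%N -> (t <= size Y)%N ->
  (size (popular X Y t) <= (size X - t) + (size Y - t) + 2 * E)%N.
Proof.
move=> uX uY defE Et tX tY; have [E0 Et'] := andP Et.
have := @excess_popular_le X Y t E Et'.
have := pollard (t - E) uX uY; move: defE.
have -> : (size X - (t - E) = size X - t + E)%N by lia.
have -> : (size Y - (t - E) = size Y - t + E)%N by lia.
move: (size X - t)%N (size Y - t)%N => p q h1 h2 h3.
have : (E * size (popular X Y t) <= E * (p + q + 2 * E))%N by nia.
by rewrite leq_pmul2l.
Qed.

(** The same comparison with the level [t + E]. *)
Lemma popular_lower (X Y : seq int) t E : uniq X -> uniq Y ->
  ((size X - t) * (size Y - t) <= excess X Y t + E * E)%N ->
  (0 < E)%N -> (E <= size X - t)%N -> (E <= size Y - t)%N ->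
  ((size X - t) + (size Y - t) <= size (popular X Y t) + 2 * E)%N.
Proof.
move=> uX uY defE E0 Ep Eq; have := @excess_popular_ge X Y t E.
have := pollard (t + E) uX uY; move: defE; rewrite !subnDA.
move: Ep Eq; move: (size X - t)%N (size Y - t)%N => p q Ep Eq h1 h2 h3.
have : (E * (p + q) <= E * (size (popular X Y t) + 2 * E))%N.
  move: h1 h2 h3 (subnK Ep) (subnK Eq).
  move: (p - E)%N (q - E)%N => p' q' h1 h2 h3 hp hq; rewrite -hp -hq in h1 *; nia.
by rewrite leq_pmul2l.
Qed.

(** Lowering the level by [e] costs little: to first order the deficit does not
    change, because the popular set has the size expected of an interval up to
    [2 * E]. *)
Lemma shift_level (X Y : seq int) t E e : uniq X -> uniq Y ->
  ((size X - t) * (size Y - t) <= excess X Y t + E * E)%N ->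
  (0 < E)%N -> (E <= size X - t)%N -> (E <= size Y - t)%N -> (e <= t)%N ->
  (t <= size X)%N -> (t <= size Y)%N ->
  ((size X - (t - e)) * (size Y - (t - e))
   <= excess X Y (t - e) + (E + e) * (E + e))%N.
Proof.
move=> uX uY defE E0 Ep Eq et tX tY; have := popular_lower uX uY defE E0 Ep Eq.
have := excess_popular_le X Y et; move: defE.
have -> : (size X - (t - e) = size X - t + e)%N by lia.
have -> : (size Y - (t - e) = size Y - t + e)%N by lia.
nia.
Qed.

Lemma leq_sum_sub (s u : seq int) (F : int -> nat) : uniq s ->
  (forall z, z \in s -> (0 < F z)%N -> z \in u) ->
  (\sum_(z <- s) F z <= \sum_(z <- u) F z)%N.
Proof.
move=> us su.
have -> : (\sum_(z <- s) F z = \sum_(z <- [seq z <- s | (0 < F z)%N]) F z)%N.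
  rewrite big_filter [RHS]big_mkcond /=; apply: eq_bigr => z _.
  by case: ltnP => //; rewrite leqn0 => /eqP.
apply: (@sub_le_big_seq _ _ leq) => // [a b|z]; first exact: leq_addr.
case: (boolP (z \in [seq z <- s | (0 < F z)%N])) => [|/count_memPn -> //].
rewrite count_uniq_mem ?filter_uniq // mem_filter => /andP[Fz zs].
by rewrite Fz zs -has_count has_pred1 su.
Qed.

Lemma sum_sub_excess (X Y s : seq int) t : uniq s ->
  (\sum_(z <- s) (rep X Y z - t) <= excess X Y t)%N.
Proof.
move=> us; apply: leq_sum_sub => // z _; rewrite subn_gt0 -mem_popular.
by rewrite mem_filter => /andP[].
Qed.

Lemma sum_popular (X Y : seq int) t :
  (\sum_(z <- popular X Y t) rep X Y z = excess X Y t + t * size (popular X Y t))%N.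
Proof.
rewrite size_popular -sum1_count big_distrr /= [X in (_ + X)%N]big_mkcond -big_split /=.
rewrite big_filter [LHS]big_mkcond /=; apply: eq_bigr => z _.
by case: ltnP => h; lia.
Qed.

(** Counting the triples [x + y = z] with [z] in [C] by [z] and by [y]. *)
Lemma triple_count (X Y C : seq int) : uniq X -> uniq Y -> uniq C ->
  (\sum_(z <- C) rep X Y z = \sum_(w <- negs Y) rep X (negs C) w)%N.
Proof.
move=> uX uY uC; rewrite /rep sum_count_exchange [RHS]sum_count_exchange; apply: eq_bigr => x _.
rewrite count_negs; apply/eqP; rewrite eqn_leq; apply/andP; split.
  apply: (@count_inj _ _ (fun z => z - x)) => // [z z' _ _ _ _|z zC h]; first by lia.
  by rewrite h mem_negs; have -> : - (- (z - x) - x) = z by ring.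
apply: (@count_inj _ _ (fun y => y + x)) => // [z z' _ _ _ _|y yY]; first by lia.
rewrite mem_negs; have -> : - (- y - x) = y + x by ring.
by move=> ->; have -> : y + x - x = y by ring.
Qed.

(** The number of triples [x + y = z] with [z] popular is nearly maximal, and this
    is a symmetric property of the three sets.  So the pair [X], [negs C] has a
    small deficit as well, at the complementary level [size X - t], which may be
    moved by [e] for the same reason as in [shift_level]. *)
Lemma dual_deficit (X Y : seq int) t E e : uniq X -> uniq Y ->
  ((size X - t) * (size Y - t) <= excess X Y t + E * E)%N ->
  (0 < E <= t)%N -> (E + e <= size X - t)%N -> (2 * E + e <= size Y - t)%N ->
  (t <= size X)%N -> (t <= size Y)%N ->
  forall C s, C = popular X Y t -> s = (size X - t - e)%N ->
  ((size X - s) * (size (negs C) - s)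
   <= excess X (negs C) s + (E + e) * (E + e))%N.
Proof.
move=> uX uY defE Et Ep Eq tX tY C s defC defs.
have uC : uniq C by rewrite defC; apply: uniq_popular.
have hC : (size C <= (size X - t) + (size Y - t) + 2 * E)%N by rewrite defC; apply: popular_upper.
have lC : ((size X - t) + (size Y - t) <= size C + 2 * E)%N.
  by rewrite defC; apply: popular_lower => //; lia.
have h1 : (\sum_(w <- negs Y) rep X (negs C) w <= excess X (negs C) s + s * size Y)%N.
  apply: (@leq_trans (\sum_(w <- negs Y) ((rep X (negs C) w - s) + s))%N).
    by apply: leq_sum => w _; lia.
  rewrite big_split /= big_const_seq iter_addn_0 count_predT size_negs.
  by rewrite leq_add2r sum_sub_excess // uniq_negs.
move: h1; rewrite -triple_count // defC sum_popular -defC size_negs => h1.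
rewrite defs in h1 *.
have -> : (size X - (size X - t - e) = t + e)%N by lia.
move: defE h1 hC lC Ep Eq Et; move: (size C) (excess X (negs C) _) (excess _ _ _) => c d2 d1.
have -> : size Y = (size Y - t + t)%N by lia.
move: (size X - t)%N (size Y - t)%N => p q.
rewrite addnK.
move=> h1 h2 h3 h4 h5 h6 h7.
have [p' pE] : (exists p', p = p' + e)%N by exists (p - e)%N; lia.
rewrite pE addnK in h1 h2 h3 h4 *.
have [c' cE] : (exists c', c = p' + c')%N by exists (c - p')%N; lia.
rewrite cE in h2 h3 h4 *; have -> : (p' + c' - p' = c')%N by lia.
have : (e * c' <= e * (e + q + 2 * E))%N by rewrite leq_mul2l; lia.
nia.
Qed.

Lemma rep_sym (X Y : seq int) z : uniq X -> uniq Y -> rep X Y z = rep Y X z.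
Proof.
have half (U V : seq int) : uniq U -> (rep U V z <= rep V U z)%N.
  move=> uU; apply: (@count_inj _ _ (fun x => z - x)) => // [x x' _ _ _ _|x xU ->]; first by lia.
  by have -> : z - (z - x) = x by ring.
by move=> uX uY; apply/eqP; rewrite eqn_leq !half.
Qed.

Lemma excess_sym (X Y : seq int) t : uniq X -> uniq Y -> excess X Y t = excess Y X t.
Proof.
move=> uX uY; rewrite /excess; under eq_bigr do rewrite rep_sym //.
apply/perm_big/uniq_perm; rewrite ?undup_uniq // => z; rewrite !mem_undup.
by apply/allpairsP/allpairsP => -[[x y] /= [xX yY ->]]; exists (y, x); rewrite addrC.
Qed.

Lemma rep_negs (X Y : seq int) z : rep (negs X) (negs Y) z = rep X Y (- z).
Proof.
rewrite /rep count_negs; apply: eq_count => x; rewrite mem_negs.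
by have -> : - (z - - x) = - z - x by ring.
Qed.

Lemma excess_negs (X Y : seq int) t : excess (negs X) (negs Y) t = excess X Y t.
Proof.
rewrite /excess; under eq_bigr do rewrite rep_negs.
rewrite -(big_map (fun z => - z) xpredT (fun z => rep X Y z - t)%N) /=.
apply/perm_big/uniq_perm; rewrite ?uniq_negs ?undup_uniq // => z.
rewrite mem_negs !mem_undup.
apply/allpairsP/allpairsP => -[[x y] /= [xX yY e]]; exists (- x, - y) => /=.
  by rewrite -!mem_negs; split=> //; lia.
by rewrite !mem_negs !opprK; split=> //; lia.
Qed.
(** * Sets that are nearly invariant under translations *)

Lemma count_itv (s : seq int) (a : int) (n : nat) : uniq s ->
  (count (fun y : int => (a < y <= a + n%:Z)%R) s <= n)%N.
Proof.
move=> us; rewrite -[X in (_ <= X)%N](size_iota 0 n) -(count_predT (iota 0 n)).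
apply: (@count_inj _ _ (fun y => absz (y - a - 1)%R)) => // [x y _ _|x _].
  by move=> /andP[? ?] /andP[? ?]; lia.
by rewrite mem_iota andbT => /andP[? ?]; lia.
Qed.

(** The defect of translation invariance under [h] of a set living in
    [[lo, hi]]. *)
Definition drift (S : seq int) (lo hi h : int) :=
  count (fun y => (lo <= y + h <= hi) && (y + h \notin S)) S.

Definition window (S : seq int) (W : nat) (z : int) :=
  (\sum_(0 <= i < W) (z - 1 - i%:Z \in S)%R)%N.

Lemma window_step (S : seq int) W z :
  (window S W z <= window S W (z + 1)%R + (z \notin S))%N.
Proof.
case: W => [|W]; first by rewrite /window !big_geq.
rewrite /window big_nat_recr //= [X in (_ <= X + _)%N]big_nat_recl //=.
have -> : (\sum_(0 <= i < W) ((z + 1 - 1 - i.+1%:Z)%R \in S)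
   = \sum_(0 <= i < W) ((z - 1 - i%:Z)%R \in S))%N.
  by apply: eq_bigr => i _; congr (nat_of_bool (_ \in S)); lia.
have -> : z + 1 - 1 - 0%:Z = z by lia.
have := leq_b1 (z - 1 - W%:Z \in S); move: (nat_of_bool _) (\sum_(_ <= _ < _) _)%N => b n b1.
by case: (z \in S) => /=; lia.
Qed.

(** Double counting: each hole preceded by many elements contributes to many
    drifts. *)
Lemma window_holes (S s : seq int) lo hi (W d c : nat) : uniq S -> uniq s ->
  (forall z, z \in S -> lo <= z <= hi) ->
  (forall z, z \in s -> lo <= z <= hi) -> (forall z, z \in s -> z \notin S) ->
  (forall n : nat, (0 < n <= W)%N -> (drift S lo hi n%:Z <= d)%N) ->
  (forall z, z \in s -> (c <= window S W z)%N) ->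
  (size s * c <= W * d)%N.
Proof.
move=> uS us Sb sb sS dr cw.
have := @markov_sum _ s (window S W) predT c (fun z zs _ => cw z zs).
rewrite count_predT => /leq_trans; apply.
rewrite /window exchange_big /=.
apply: (@leq_trans (\sum_(0 <= i < W) d)%N); last by rewrite sum_nat_const_nat subn0.
rewrite big_nat_cond [leqRHS]big_nat_cond; apply: leq_sum => i /andP[iW _].
rewrite -big_mkcond sum1_count; apply: leq_trans (dr i.+1 _); last by lia.
apply: (@count_inj _ _ (fun z => z - 1 - i%:Z)) => // [x y _ _ _ _|z zs zS]; first by lia.
have -> : z - 1 - i%:Z + i.+1%:Z = z by lia.
by rewrite zS sb // sS.
Qed.

(** A window that is half full at [z1] stays well filled further to the right:
    it loses an element only when it passes a hole, and by [window_holes] there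
    are few holes as long as the windows are well filled. *)
Lemma right_holes (S s : seq int) lo hi (d : nat) z1 : (0 < d)%N -> uniq S -> uniq s ->
  (forall z, z \in S -> lo <= z <= hi) ->
  (forall n : nat, (0 < n <= 30 * d)%N -> (drift S lo hi n%:Z <= d)%N) ->
  lo <= z1 -> (15 * d <= window S (30 * d) z1)%N ->
  (forall z, z \in s -> (z1 <= z <= hi) && (z \notin S)) ->
  (size s <= 10 * d)%N.
Proof.
move=> d0 uS us Sb dr loz1 w1 sh.
(* Windows have length [30 * d], so holes whose windows contain [3 * d] elements
   number at most [10 * d]; what remains of [15 * d] elements is still [3 * d]. *)
have few t : uniq t -> (forall z, z \in t -> [&& z1 <= z, z <= hi & z \notin S]) ->
    (forall z, z \in t -> (3 * d <= window S (30 * d) z)%N) -> (size t <= 10 * d)%N.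
  move=> ut th tw.
  have : (size t * (3 * d) <= (30 * d) * d)%N.
    apply: (@window_holes S t lo hi) => // z /th /and3P[] //; lia.
  nia.
pose holes k := [seq z <- [seq z1 + i%:Z | i <- iota 0 k] | z \notin S].
have step k : (window S (30 * d) z1 <= window S (30 * d) (z1 + k%:Z)%R + size (holes k))%N.
  elim: k => [|k IH]; first by rewrite addr0 leq_addr.
  have := window_step S (30 * d) (z1 + k%:Z).
  have -> : z1 + k%:Z + 1 = z1 + k.+1%:Z by lia.
  have -> : size (holes k.+1) = (size (holes k) + ((z1 + k%:Z)%R \notin S))%N.
    rewrite /holes -(addn1 k) iotaD map_cat filter_cat size_cat /= add0n.
    by case: (_ \notin S).
  move=> h; apply: leq_trans IH _; apply: leq_trans (leq_add h (leqnn _)) _.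
  by rewrite addnAC addnA.
have bound k : z1 + k%:Z <= hi + 1 -> (size (holes k) <= 10 * d)%N.
  elim/ltn_ind: k => k IH kh; apply: few.
  - by rewrite filter_uniq // map_inj_uniq ?iota_uniq // => i j; lia.
  - move=> z; rewrite mem_filter => /andP[-> /mapP[i]]; rewrite mem_iota => ik ->; lia.
  - move=> z; rewrite mem_filter => /andP[_ /mapP[i]]; rewrite mem_iota => ik ->.
    have := IH i ltac:(lia) ltac:(lia); move: (step i) w1.
    move: (window _ _ z1) (window _ _ (z1 + _)) => a b; lia.
apply: few => // z /sh; first by move=> /andP[/andP[-> ->] ->].
move=> /andP[/andP[z1z zhi] _]; have := step `|z - z1|%N; have := bound `|z - z1|%N.
have -> : z1 + `|z - z1|%N%:Z = z by lia.
move: w1; move: (window _ _ z1) (window _ _ z) => a b; lia.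
Qed.

(** Averaging over the elements of small rank and over all shifts: few of the
    translates fall into a hole. *)
Lemma window_start (S : seq int) lo hi (d : nat) : (0 < d)%N -> uniq S ->
  (forall z, z \in S -> lo <= z <= hi) ->
  (forall n : nat, (0 < n <= 30 * d)%N -> (drift S lo hi n%:Z <= d)%N) ->
  (40 * d <= size S)%N ->
  exists x, [/\ x \in S, (below S x < 2 * d)%N
    & (15 * d <= window S (30 * d) (x + 1 + (30 * d)%N%:Z)%R)%N].
Proof.
move=> d0 uS Sb dr sS; set W := (30 * d)%N.
pose low x := (below S x < 2 * d)%N.
pose F x := count (fun n : nat => low x && ((x + n%:Z)%R \notin S)) (iota 1 W).
have inhi x : x \in S -> low x -> x + W%:Z <= hi.
  move=> xS lx; have := below_above uS xS.
  have : (above S x <= `|hi - x|)%N.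
    apply: leq_trans (@count_itv S x `|hi - x|%N uS).
    by apply: count_imply => y /Sb; lia.
  have := Sb _ xS; rewrite /low in lx; lia.
have sumF : (\sum_(x <- S) F x <= W * d)%N.
  rewrite sum_count_exchange.
  apply: (@leq_trans (\sum_(n <- iota 1 W) (d))%N); last first.
    by rewrite big_const_seq iter_addn_0 count_predT size_iota mulnC.
  rewrite big_seq_cond [leqRHS]big_seq_cond; apply: leq_sum => n.
  rewrite mem_iota andbT => nW; apply: leq_trans (dr n _); last by lia.
  apply: count_imply => x xS /andP[lx ->]; rewrite andbT.
  have := inhi x xS lx; have := Sb x xS; lia.
have [] := @count_exists _ S low (fun x => 15 * d < F x)%N.
  have := @markov_sum _ S F (fun x => 15 * d < F x)%N (15 * d).+1 (fun x _ h => h).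
  rewrite count_below_lt // (minn_idPl _); last by lia.
  rewrite /W in sumF; move: sumF (count _ S) => h c h'.
  rewrite ltnNge; apply/negP => h''.
  have := leq_trans (leq_trans (leq_mul h'' (leqnn _)) h') h; nia.
move=> x [xS lx Fx]; exists x; split=> //; move: Fx; rewrite -leqNgt /F lx /=.
have := count_predC (fun n : nat => x + n%:Z \in S) (iota 1 W); rewrite size_iota.
have -> : window S W (x + 1 + W%:Z) = count (fun n : nat => x + n%:Z \in S) (iota 1 W).
  have -> : iota 1 W = index_iota 1 W.+1 by rewrite /index_iota subn1.
  rewrite /window -sum1_count [RHS]big_mkcond big_add1 /= big_nat_rev add0n.
  rewrite big_nat_cond [RHS]big_nat_cond; apply: eq_bigr => i /andP[iW _].
  have -> : x + 1 + W%:Z - 1 - (W - i.+1)%N%:Z = x + i.+1%:Z by lia.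
  by case: (_ \in S).
move=> hC Fx; have : (count (predC (fun n : nat => (x + n%:Z)%R \in S)) (iota 1 W) <= 15 * d)%N.
  exact: Fx.
by move: hC; rewrite {3}/W; move: (count (predC _) _) (count _ _) => b a; lia.
Qed.

(** [right_holes] applies from near the left end and, after negation, from near
    the right end; as the set is large, the two ranges cover everything. *)
Lemma drift_holes (S s : seq int) lo hi (d : nat) : (0 < d)%N -> uniq S -> uniq s ->
  (forall z, z \in S -> lo <= z <= hi) ->
  (forall n : nat, (0 < n <= 30 * d)%N -> (drift S lo hi n%:Z <= d)%N) ->
  (forall n : nat, (0 < n <= 30 * d)%N -> (drift S lo hi (- n%:Z) <= d)%N) ->
  (70 * d <= size S)%N ->
  (forall z, z \in s -> (lo <= z <= hi) && (z \notin S)) ->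
  (size s <= 20 * d)%N.
Proof.
move=> d0 uS us Sb dr dl sS sh; set W := (30 * d)%N.
have nb z : z \in negs S -> - hi <= z <= - lo by rewrite mem_negs => /Sb; lia.
have nd (n : nat) : (0 < n <= W)%N -> (drift (negs S) (- hi) (- lo) n%:Z <= d)%N.
  move=> /dl; apply: leq_trans; rewrite /drift count_negs; apply: count_imply => y _.
  rewrite mem_negs; have -> : - (- y + n%:Z) = y + - n%:Z by ring.
  by case/andP => h ->; rewrite andbT; lia.
have nu : uniq (negs S) by rewrite uniq_negs.
have [|x [xS xl wx]] := @window_start S lo hi d d0 uS Sb dr; first by lia.
have [|x' [x'S xl' wx']] := @window_start (negs S) (- hi) (- lo) d d0 nu nb nd.
  by rewrite size_negs; lia.
have R : (size [seq z <- s | (x + 1 + W%:Z <= z)%R] <= 10 * d)%N.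
  apply: (@right_holes S _ lo hi d (x + 1 + W%:Z)) => //; first by rewrite filter_uniq.
    by have := Sb _ xS; lia.
  by move=> z; rewrite mem_filter => /andP[-> /sh /andP[/andP[_ ->] ->]].
have L : (size [seq z <- negs s | (x' + 1 + W%:Z <= z)%R] <= 10 * d)%N.
  apply: (@right_holes (negs S) _ (- hi) (- lo) d (x' + 1 + W%:Z)) => //.
  - by rewrite filter_uniq ?uniq_negs.
  - by have := nb _ x'S; lia.
  - move=> z; rewrite mem_filter !mem_negs => /andP[-> /sh /andP[/andP[h1 h2] ->]].
    by rewrite andbT /=; lia.
move: R L; rewrite !size_filter count_negs => R L.
have far : (61 * d <= `|- x' - x|)%N /\ x <= - x'.
  have [e|e] := lerP x (- x').
    split=> //; have := below_above uS xS.
    have : (above S x <= above S (- x') + `|- x' - x|%N)%N.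
      apply: leq_trans (leq_add (leqnn _) (@count_itv S x `|- x' - x|%N uS)).
      by apply: count_split => y _; lia.
    have : above S (- x') = below (negs S) x' by rewrite above_negs opprK.
    lia.
  have := below_above uS xS.
  have := above_mono S (ltW e); rewrite (above_negs S (- x')) opprK; lia.
rewrite -(count_predT s).
apply: leq_trans (@count_split _ s predT (fun z => (x + 1 + W%:Z <= z)%R)
   (fun z => (x' + 1 + W%:Z <= - z)%R) _) _.
  by move=> z _ _; rewrite /W; lia.
by apply: leq_trans (leq_add R L) _; lia.
Qed.
(** * Sets with few relevant sums *)

Definition misses (C B : seq int) (x : int) := count (fun y : int => x + y \notin C) B.

Lemma misses_sum_sym (A B C : seq int) :
  (\sum_(x <- A) misses C B x = \sum_(y <- B) misses C A y)%N.
Proof.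
rewrite /misses sum_count_exchange; apply: eq_bigr => y _.
by apply: eq_count => x; rewrite addrC.
Qed.

Lemma few_bad (A B C : seq int) (E : nat) : (0 < E)%N ->
  (\sum_(x <- A) misses C B x <= 16 * (E * E))%N ->
  (count (fun x : int => 16 * E < misses C B x)%N A < E)%N.
Proof.
move=> E0 h.
have := @markov_sum _ A (misses C B) (fun x : int => 16 * E < misses C B x)%N
  (16 * E).+1 (fun x _ h => h).
move: (count _ _) => c /leq_trans/(_ h); nia.
Qed.

Lemma good_below (A B C : seq int) (E : nat) : (0 < E)%N -> uniq A -> (E <= size A)%N ->
  (\sum_(x <- A) misses C B x <= 16 * (E * E))%N ->
  exists x, [/\ x \in A, (below A x < E)%N & (misses C B x <= 16 * E)%N].
Proof.
move=> E0 uA sA h.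
have [| x [xA lx]] := @count_exists _ A (fun x : int => below A x < E)%N
  (fun x : int => 16 * E < misses C B x)%N.
  by rewrite count_below_lt // (minn_idPl sA); apply: few_bad.
by rewrite -leqNgt => gx; exists x.
Qed.

Lemma good_above (A B C : seq int) (E : nat) : (0 < E)%N -> uniq A -> (E <= size A)%N ->
  (\sum_(x <- A) misses C B x <= 16 * (E * E))%N ->
  exists x, [/\ x \in A, (above A x < E)%N & (misses C B x <= 16 * E)%N].
Proof.
move=> E0 uA sA h.
have [| x [xA lx]] := @count_exists _ A (fun x : int => above A x < E)%N
  (fun x : int => 16 * E < misses C B x)%N.
  by rewrite count_above_lt // (minn_idPl sA); apply: few_bad.
by rewrite -leqNgt => gx; exists x.
Qed.

Lemma count_disjoint4 (T : Type) (s : seq T) (P1 P2 P3 P4 : pred T) :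
  (forall z, P1 z + P2 z + P3 z + P4 z <= 1)%N ->
  (count P1 s + count P2 s + count P3 s + count P4 s <= size s)%N.
Proof. by move=> h; elim: s => //= z s IH; have := h z; lia. Qed.

(** The sums along a monotone chain running through the row of [x] already fill
    [C]: left of [x] along the bottom column, then along the row, then right of
    [x] along the top column.  Hence in the range of the row, [C] contains
    little besides the row. *)
Lemma row_fills (A B C : seq int) (E : nat) x y0 y1 : (0 < E)%N ->
  uniq A -> uniq B -> uniq C ->
  (size C <= size A + size B + 8 * E)%N ->
  x \in A -> (misses C B x <= 16 * E)%N ->
  (misses C A y0 <= 16 * E)%N -> (misses C A y1 <= 16 * E)%N ->
  y0 \in B -> y1 \in B -> (below B y0 < E)%N -> (above B y1 < E)%N -> 
  (count (fun z : int => (x + y0 <= z <= x + y1)%R && ((z - x)%R \notin B)) C <= 58 * E)%N.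
Proof.
move=> E0 uA uB uC sC xA gx g0 g1 y0B y1B l0 l1.
pose P1 (z : int) := z < x + y0.
pose P2 (z : int) := x + y1 < z.
pose P3 (z : int) := (x + y0 <= z <= x + y1) && (z - x \in B).
pose P4 (z : int) := (x + y0 <= z <= x + y1) && (z - x \notin B).
have [y01|] := lerP y0 y1; last first.
  move=> y10; rewrite (@eq_count _ _ pred0) ?count_pred0 // => z /=.
  by apply/negbTE; rewrite negb_and; apply/orP; left; lia.
have c1 : (below A x <= count P1 C + 16 * E)%N.
  apply: leq_trans (leq_add (leqnn _) g0).
  apply: (@leq_trans (count (fun x' => (x' < x)%R && ((y0 + x')%R \in C)) A + misses C A y0)%N).
    by apply: count_split => x' _ ->; rewrite orbN.
  rewrite leq_add2r; apply: (@count_inj _ _ (fun x' => y0 + x')) => // [a b _ _ _ _|a _].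
    by lia.
  by case/andP => h ->; rewrite /P1; lia.
have c2 : (above A x <= count P2 C + 16 * E)%N.
  apply: leq_trans (leq_add (leqnn _) g1).
  apply: (@leq_trans (count (fun x' => (x < x')%R && ((y1 + x')%R \in C)) A + misses C A y1)%N).
    by apply: count_split => x' _ ->; rewrite orbN.
  rewrite leq_add2r; apply: (@count_inj _ _ (fun x' => y1 + x')) => // [a b _ _ _ _|a _].
    by lia.
  by case/andP => h ->; rewrite /P2; lia.
have c3 : (size B <= count P3 C + 16 * E + below B y0 + above B y1)%N.
  rewrite -(count_predT B) -addnA.
  pose Q (y : int) := ((y < y0) || (y1 < y))%R.
  apply: (@leq_trans (count (predC Q) B + count Q B)%N).
    by rewrite addnC count_predC count_predT.
  apply: leq_add; last by apply: count_split => y _ /orP[->|->]; rewrite ?orbT.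
  apply: leq_trans (leq_add (leqnn _) gx).
  apply: (@leq_trans (count (fun y : int => (predC Q y) && ((x + y)%R \in C)) B + misses C B x)%N).
    by apply: count_split => y _ ->; rewrite orbN.
  rewrite leq_add2r; apply: (@count_inj _ _ (fun y : int => x + y)) => // [a b _ _ _ _|a aB].
    by lia.
  case/andP => h ->; rewrite /P3; have -> : x + a - x = a by ring.
  by rewrite aB; move: h; rewrite /Q /=; lia.
have := @count_disjoint4 _ C P1 P2 P3 P4.
have := below_above uA xA.
move=> h1 h2; have {h2} : (count P1 C + count P2 C + count P3 C + count P4 C <= size C)%N.
  by apply: h2 => z; rewrite /P1 /P2 /P3 /P4; case: (_ \in B); lia.
rewrite -/P4; lia.
Qed.

(** Two good rows differ by a translation under which the columns are nearly
    invariant. *)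
Lemma row_shift (A B C : seq int) (E : nat) x x' y0 y1 : (0 < E)%N ->
  uniq A -> uniq B -> uniq C ->
  (size C <= size A + size B + 8 * E)%N ->
  x \in A -> (misses C B x <= 16 * E)%N ->
  x' \in A -> (misses C B x' <= 16 * E)%N ->
  (misses C A y0 <= 16 * E)%N -> (misses C A y1 <= 16 * E)%N ->
  y0 \in B -> y1 \in B -> (below B y0 < E)%N -> (above B y1 < E)%N ->
  (drift [seq y <- B | (y0 <= y <= y1)%R] y0 y1 (x' - x)%R <= 74 * E)%N.
Proof.
move=> E0 uA uB uC sC xA gx x'A gx' g0 g1 y0B y1B l0 l1.
have := row_fills E0 uA uB uC sC xA gx g0 g1 y0B y1B l0 l1 => h.
pose P (y : int) := [&& (y0 <= y + (x' - x) <= y1), y + (x' - x) \notin B & x' + y \in C].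
apply: (@leq_trans (count P B + misses C B x')%N).
  rewrite /drift count_filter; apply: count_split => y yB.
  rewrite /= mem_filter => /andP[/andP[h1 +] _]; rewrite /P h1 /= => ->.
  by rewrite orbN.
apply: (@leq_trans (58 * E + 16 * E)%N); last by lia.
apply: leq_add gx'; apply: leq_trans h.
apply: (@count_inj _ _ (fun y : int => x' + y)) => // [a b _ _ _ _|y _]; first by lia.
case/and3P => h1 h2 ->; have -> : x' + y - x = y + (x' - x) by ring.
by rewrite h2 andbT /=; lia.
Qed.

(** An element leaves the set under translation by [n] only if it is beyond one
    of the ends [y0], [y1], among the last [n] integers below [y1], or counted
    by the drift. *)
Lemma overlap (B : seq int) (E d n : nat) y0 y1 : uniq B ->
  (below B y0 < E)%N -> (above B y1 < E)%N ->
  (drift [seq y <- B | (y0 <= y <= y1)%R] y0 y1 n%:Z <= d)%N ->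
  (size B <= count (fun y : int => (y + n%:Z)%R \in B) B + (2 * E + n + d))%N.
Proof.
move=> uB l0 l1 dr.
have := @count_itv B (y1 - n%:Z) n uB.
rewrite subrK => h2.
pose P (y : int) := y + n%:Z \in B.
pose Q1 (y : int) := (y0 <= y) && ~~ P y.
pose Q2 (y : int) := (y <= y1) && Q1 y.
pose D (y : int) := (y0 <= y + n%:Z <= y1) && Q2 y.
have hD : (count D B <= d)%N.
  apply: leq_trans dr; rewrite /drift count_filter; apply: count_imply => y yB.
  rewrite /D /Q2 /Q1 /P /= mem_filter => /and4P[-> -> -> /negbTE ->].
  by rewrite andbF.
have s0 : (size B <= count (fun y : int => (y + n%:Z)%R \in B) B + count (predC P) B)%N.
  by rewrite (count_predC P).
have s1 : (count (predC P) B <= below B y0 + count Q1 B)%N.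
  by apply: count_split => y _ /= nP; rewrite /Q1 nP; lia.
have s2 : (count Q1 B <= above B y1 + count Q2 B)%N.
  by apply: count_split => y _ /= q; rewrite /Q2 q; lia.
have s3 : (count Q2 B <= count D B + count (fun y : int => (y1 - n%:Z < y <= y1)%R) B)%N.
  apply: count_split => y _ q; rewrite /D q; move: q => /andP[q /andP[q' _]]; lia.
apply: leq_trans s0 _; rewrite leq_add2l; apply: leq_trans s1 _.
apply: leq_trans (leq_add (ltnW l0) (leq_trans s2 (leq_add (ltnW l1) (leq_trans s3
  (leq_add hD h2))))) _.
by lia.
Qed.

(** Each of the requirements on [x - j] and on [x + n] fails for few [x] only. *)
Lemma good_pair (A B C : seq int) (E n k : nat) (j : int) : (0 < E)%N -> uniq A ->
  (\sum_(x <- A) misses C B x <= 16 * (E * E))%N ->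
  (count (fun x : int => (x - j)%R \notin A) A <= k)%N ->
  (2 * E + k <= count (fun y : int => (y + n%:Z)%R \in A) A)%N ->
  exists x, [/\ x - j \in A, x + n%:Z \in A, (misses C B (x - j)%R <= 16 * E)%N
     & (misses C B (x + n%:Z)%R <= 16 * E)%N].
Proof.
move=> E0 uA h hk hn; have hb := few_bad E0 h.
pose bad x := (16 * E < misses C B x)%N.
pose bad' h x := (x + h \in A) && bad (x + h).
have hb' i : (count (bad' i) A < E)%N.
  apply: leq_ltn_trans hb; apply: (@count_inj _ _ (fun x : int => x + i)) => //.
  by move=> a b _ _ _ _; lia.
have [| x [xA xnA]] := @count_exists _ A (fun y : int => y + n%:Z \in A)
   (fun x : int => (x - j \notin A) || (bad' (- j) x || bad' n%:Z x)).
  apply: leq_trans hn.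
  apply: (@leq_ltn_trans (k + (count (bad' (- j)%R) A + count (bad' n%:Z) A))%N).
    apply: leq_trans (leq_add hk (leqnn _)).
    apply: (@leq_trans (count (fun x : int => (x - j)%R \notin A) A +
      count (fun x : int => bad' (- j) x || bad' n%:Z x) A)%N); first exact: count_split.
    by rewrite leq_add2l; apply: count_split.
  by have := hb' (- j); have := hb' n%:Z; lia.
case/norP => /negbNE xj /norP[]; rewrite /bad' xj xnA /bad /= -!leqNgt => gx gx'.
by exists x.
Qed.

(** Differences of good rows are good translations
    for the columns, and conversely.  A good translation [n] occurs for many
    pairs of elements, and since few elements of [A] are left endpoints, also
    [n + 1] is the difference of two good rows.  Thus all translations up to a
    fixed fraction of the size are good. *)
Lemma all_shifts (A B C : seq int) (E W : nat) y0 y1 x0 x1 : (0 < E)%N ->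
  uniq A -> uniq B -> uniq C ->
  (size C <= size A + size B + 8 * E)%N ->
  (\sum_(x <- A) misses C B x <= 16 * (E * E))%N ->
  (count (fun x : int => (x - 1)%R \notin A) A <= 2 * E)%N ->
  (W + 80 * E <= size A)%N -> (W + 80 * E <= size B)%N ->
  x0 \in A -> x1 \in A -> (below A x0 < E)%N -> (above A x1 < E)%N ->
  (misses C B x0 <= 16 * E)%N -> (misses C B x1 <= 16 * E)%N ->
  y0 \in B -> y1 \in B -> (below B y0 < E)%N -> (above B y1 < E)%N ->
  (misses C A y0 <= 16 * E)%N -> (misses C A y1 <= 16 * E)%N ->
  forall n : nat, (n <= W)%N ->
    (drift [seq x <- A | (x0 <= x <= x1)%R] x0 x1 n%:Z <= 74 * E)%N /\
    (drift [seq x <- A | (x0 <= x <= x1)%R] x0 x1 (- n%:Z) <= 74 * E)%N.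
Proof.
move=> E0 uA uB uC sC hA smooth sA sB x0A x1A lx0 lx1 gx0 gx1 y0B y1B ly0 ly1 gy0 gy1.
have hB : (\sum_(y <- B) misses C A y <= 16 * (E * E))%N by rewrite -misses_sum_sym.
have sC' : (size C <= size B + size A + 8 * E)%N by rewrite (addnC (size B)).
pose PA n := exists x, [/\ x \in A, x + n%:Z \in A, (misses C B x <= 16 * E)%N
     & (misses C B (x + n%:Z)%R <= 16 * E)%N].
pose PB n := exists x, [/\ x \in B, x + n%:Z \in B, (misses C A x <= 16 * E)%N
     & (misses C A (x + n%:Z)%R <= 16 * E)%N].
have AB n : (n <= W)%N -> PA n -> PB n.
  move=> nW [x [xA x'A gx gx']].
  have := row_shift E0 uA uB uC sC xA gx x'A gx' gy0 gy1 y0B y1B ly0 ly1.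
  have -> : x + n%:Z - x = n%:Z by ring.
  move=> /(overlap uB ly0 ly1) ov.
  have [| | y []] := @good_pair B A C E n 0 0 E0 uB hB.
  - rewrite (@eq_in_count _ _ pred0) ?count_pred0 // => y yB.
    by rewrite subr0 yB.
  - by move: ov; move: (count _ B) => c; lia.
  by rewrite subr0; exists y.
have BA n : (n <= W)%N -> PB n -> forall h, h = n%:Z \/ h = - n%:Z ->
    (drift [seq x <- A | (x0 <= x <= x1)%R] x0 x1 h <= 74 * E)%N.
  move=> nW [y [yB y'B gy gy']] h [] ->.
    have := row_shift E0 uB uA uC sC' yB gy y'B gy' gx0 gx1 x0A x1A lx0 lx1.
    by have -> : y + n%:Z - y = n%:Z by ring.
  have := row_shift E0 uB uA uC sC' y'B gy' yB gy gx0 gx1 x0A x1A lx0 lx1.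
  by have -> : y - (y + n%:Z) = - n%:Z by ring.
suff PAn n : (n <= W)%N -> PA n.
  by move=> n nW; have Pn := AB n nW (PAn n nW); split; apply: (BA n) => //; [left|right].
elim: n => [_|n IH nW].
  by exists x0; rewrite addr0.
have dr := BA n ltac:(lia) (AB n ltac:(lia) (IH ltac:(lia))) n%:Z (or_introl (erefl _)).
have ov := overlap uA lx0 lx1 dr.
have [| x [h1 h2 h3 h4]] := good_pair E0 uA hA smooth (n := n).
  by move: ov; move: (count _ A) => c; lia.
exists (x - 1); have -> : x - 1 + n.+1%:Z = x + n%:Z by lia.
by [].
Qed.

(** A stability version, for sums along most pairs, of the fact that
    [|A + B| = |A| + |B| - 1] only for arithmetic progressions (or a set of size
    at most one).  The bound on the left endpoints forces the step to be [1].
    The set [A] is nearly invariant under all small translations by [all_shifts],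
    so it has few holes. *)
Lemma sumset_stability (A B C : seq int) (E : nat) : (0 < E)%N ->
  uniq A -> uniq B -> uniq C ->
  (size C <= size A + size B + 8 * E)%N ->
  (\sum_(x <- A) misses C B x <= 16 * (E * E))%N ->
  (count (fun x : int => (x - 1)%R \notin A) A <= 2 * E)%N ->
  (80 * (74 * E) <= size A)%N -> (80 * (74 * E) <= size B)%N ->
  exists lo hi : int, [/\ (count (fun x : int => ~~ (lo <= x <= hi)%R) A <= 2 * E)%N
    & forall s : seq int, uniq s -> (forall z : int, z \in s -> (lo <= z <= hi) && (z \notin A)) ->
        (size s <= 20 * (74 * E))%N].
Proof.
move=> E0 uA uB uC sC hA smooth sA sB.
have hB : (\sum_(y <- B) misses C A y <= 16 * (E * E))%N by rewrite -misses_sum_sym.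
have [| x0 [x0A lx0 gx0]] := good_below E0 uA _ hA; first by lia.
have [| x1 [x1A lx1 gx1]] := good_above E0 uA _ hA; first by lia.
have [| y0 [y0B ly0 gy0]] := good_below E0 uB _ hB; first by lia.
have [| y1 [y1B ly1 gy1]] := good_above E0 uB _ hB; first by lia.
have sh n := @all_shifts A B C E (30 * (74 * E)) y0 y1 x0 x1 E0 uA uB uC sC hA smooth
  ltac:(lia) ltac:(lia) x0A x1A lx0 lx1 gx0 gx1 y0B y1B ly0 ly1 gy0 gy1 n.
have out : (count (fun x : int => ~~ (x0 <= x <= x1)%R) A <= 2 * E)%N.
  apply: (@leq_trans (below A x0 + above A x1)%N); last by lia.
  by apply: count_split => x _; lia.
exists x0, x1; split=> // s us sh'.
apply: (@drift_holes [seq x <- A | (x0 <= x <= x1)%R] s x0 x1) => //.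
- by lia.
- by rewrite filter_uniq.
- by move=> z; rewrite mem_filter => /andP[].
- by move=> n nW; have [] := sh n ltac:(lia).
- by move=> n nW; have [] := sh n ltac:(lia).
- rewrite size_filter; have := count_predC (fun x : int => x0 <= x <= x1) A.
  move: out; rewrite /predC /=; move: (count _ A) (count _ A) => a b; lia.
- by move=> z /sh' /andP[h /negbTE nA]; rewrite h mem_filter nA andbF.
Qed.

(** * Stability in Pollard's inequality *)

(** The holes are bounded through arbitrary lists of holes, which avoids listing
    the integers between [lo] and [hi]. *)
Definition near_interval (X : seq int) (a b : nat) := exists lo hi : int,
  (count (fun x : int => ~~ (lo <= x <= hi)%R) X <= a)%N /\
  forall s : seq int, uniq s -> (forall z : int, z \in s -> (lo <= z <= hi) && (z \notin X)) ->
    (size s <= b)%N.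

(** Deleting the [t] smallest elements of [X] and the [t] largest of [Y]
    leaves two sets almost all of whose sums are popular. *)
Lemma upper_part_stability (X Y : seq int) (t E : nat) : (0 < E)%N -> uniq X -> uniq Y ->
  ((size X - t) * (size Y - t) <= excess X Y t + 16 * (E * E))%N ->
  (4 * E <= t)%N -> (80 * (74 * E) <= size X - t)%N -> (80 * (74 * E) <= size Y - t)%N ->
  (count (fun x : int => (x - 1)%R \notin X) X <= E)%N ->
  exists lo hi : int,
    (count (fun x : int => (t <= below X x)%N && ~~ (lo <= x <= hi)%R) X <= 2 * E)%N /\
    forall s : seq int, uniq s -> (forall z : int, z \in s -> (lo <= z <= hi) && (z \notin X)) ->
      (size s <= 20 * (74 * E))%N.
Proof.
move=> E0 uX uY D Et pX pY sm.
pose A := [seq x <- X | (t <= below X x)%N].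
pose B := [seq y <- Y | (t <= above Y y)%N].
have sA : size A = (size X - t)%N by rewrite size_filter count_below_ge.
have sB : size B = (size Y - t)%N by rewrite size_filter count_above_ge.
have hC : (size (popular X Y t) <= size A + size B + 8 * E)%N.
  have := @popular_upper X Y t (4 * E) uX uY; rewrite sA sB; lia.
have hbad : (\sum_(x <- A) misses (popular X Y t) B x <= 16 * (E * E))%N.
  rewrite -(leq_add2l (excess X Y t)); apply: leq_trans D.
  apply: leq_trans (bad_pairs t uX uY); rewrite leq_add2l big_filter.
  by apply: leq_sum => x _; rewrite /misses count_filter; apply: count_imply => y _ /andP[-> ->].
have hsm : (count (fun x : int => (x - 1)%R \notin A) A <= 2 * E)%N.
  have h1 : (count (fun x : int => (below X x == t)) X <= 1)%N.
    rewrite (count_below (fun i => i == t)) // -(@eq_count _ (pred1 t)) //.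
    by rewrite count_uniq_mem ?iota_uniq //; exact: leq_b1.
  apply: (@leq_trans (E + 1)%N); last by lia.
  apply: leq_trans (leq_add sm h1); rewrite count_filter.
  apply: count_split => x xX /=; rewrite mem_filter negb_and -ltnNge.
  case: (boolP (x - 1 \in X)) => // x1X; rewrite orbF => /andP[].
  have : (below X x <= below X (x - 1)%R + count_mem (x - 1)%R X)%N.
    by apply: count_split => y _ /=; lia.
  by rewrite (count_uniq_mem _ uX) x1X; lia.
have [| | lo [hi [out ho]]] := sumset_stability E0 (filter_uniq _ uX) (filter_uniq _ uY)
  (uniq_popular X Y t) hC hbad hsm; first by rewrite sA.
  by rewrite sB.
exists lo, hi; split.
  move: out; rewrite count_filter; apply: leq_trans.
  by apply: count_imply => x _ /andP[h1 h2] /=; rewrite h2.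
move=> s us sh; apply: ho => // z /sh /andP[-> /negbTE h].
by rewrite mem_filter h andbF.
Qed.

(** A finite set of integers has as many runs seen from the left as from the
    right. *)
Lemma smooth_negs (X : seq int) : uniq X ->
  count (fun x : int => (x - 1)%R \notin negs X) (negs X) = count (fun x : int => (x - 1)%R \notin X) X.
Proof.
move=> uX; rewrite count_negs.
have e : count (fun x : int => x + 1 \in X) X = count (fun x : int => x - 1 \in X) X.
  apply/eqP; rewrite eqn_leq; apply/andP; split.
    apply: (@count_inj _ _ (fun x : int => x + 1)) => // [x y _ _ _ _|x xX x1]; first by lia.
    by rewrite x1 addrK.
  apply: (@count_inj _ _ (fun x : int => x - 1)) => // [x y _ _ _ _|x xX x1]; first by lia.
  by rewrite x1 subrK.
have := count_predC (fun x : int => x + 1 \in X) X.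
rewrite -(count_predC (fun x : int => x - 1 \in X) X) e => /addnI <-.
by apply: eq_count => x /=; rewrite mem_negs; congr (~~ (_ \in X)); ring.
Qed.

(** If [t] is less than half the size of [X], the parts of [X] of rank at least
    [t] from either end overlap, and the two intervals merge into one. *)
Lemma low_level_stability (X Y : seq int) (t E : nat) : (0 < E)%N -> uniq X -> uniq Y ->
  ((size X - t) * (size Y - t) <= excess X Y t + 16 * (E * E))%N ->
  (4 * E <= t)%N -> (80 * (74 * E) <= size X - t)%N -> (80 * (74 * E) <= size Y - t)%N ->
  (count (fun x : int => (x - 1)%R \notin X) X <= E)%N -> (2 * t + 4 * E < size X)%N ->
  near_interval X (4 * E) (40 * (74 * E)).
Proof.
move=> E0 uX uY D Et pX pY sm tX.
have [l1 [h1 [out1 g1]]] := upper_part_stability E0 uX uY D Et pX pY sm.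
have uX' : uniq (negs X) by rewrite uniq_negs.
have uY' : uniq (negs Y) by rewrite uniq_negs.
have [| | | | | l2 [h2 [out2 g2]]] := @upper_part_stability (negs X) (negs Y) t E E0 uX' uY'.
- by rewrite excess_negs !size_negs.
- by [].
- by rewrite size_negs.
- by rewrite size_negs.
- by rewrite smooth_negs.
have out2' : (count (fun x : int => (t <= above X x)%N && ~~ (- h2 <= x <= - l2)%R) X <= 2 * E)%N.
  apply: leq_trans out2; rewrite count_negs; apply: count_imply => x _.
  by rewrite above_negs => /andP[->] /=; lia.
have [| x0 [x0X r1]] := @count_exists _ X (fun x : int => t <= below X x)%N
  (fun x : int => [|| (above X x < t)%N, (t <= below X x)%N && ~~ (l1 <= x <= h1)%R
     | (t <= above X x)%N && ~~ (- h2 <= x <= - l2)%R]).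
  apply: (@leq_ltn_trans (t + (2 * E + 2 * E))%N); last by rewrite count_below_ge //; lia.
  apply: leq_trans (@count_split _ _ _ (fun x : int => above X x < t)%N
     (fun x : int => (t <= below X x)%N && ~~ (l1 <= x <= h1)%R
       || (t <= above X x)%N && ~~ (- h2 <= x <= - l2)%R) _) _ => //.
  apply: leq_add; first by rewrite count_above_lt // geq_minl.
  by apply: leq_trans (leq_add out1 out2'); apply: count_split.
rewrite !negb_or -leqNgt r1 => /and3P[r2 /= /negbNE i1]; rewrite r2 /= => /negbNE i2.
exists (Num.min l1 (- h2)), (Num.max h1 (- l2)); split.
  apply: (@leq_trans (2 * E + 2 * E)%N); last by lia.
  apply: leq_trans (leq_add out1 out2'); apply: count_split => x xX h.
  have := below_above uX xX; lia.
move=> s us sh.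
pose s1 := [seq z <- s | (l1 <= z <= h1)%R].
pose s2 := [seq z <- s | (- h2 <= z <= - l2)%R].
have b1 : (size s1 <= 20 * (74 * E))%N.
  apply: g1 => [| z]; first by rewrite filter_uniq.
  by rewrite mem_filter => /andP[-> /sh /andP[_ ->]].
have b2 : (size s2 <= 20 * (74 * E))%N.
  rewrite -size_negs; apply: g2 => [| z]; first by rewrite uniq_negs filter_uniq.
  by rewrite !mem_negs mem_filter => /andP[h /sh /andP[_ ->]]; rewrite andbT; lia.
apply: (@leq_trans (20 * (74 * E) + 20 * (74 * E))%N); last by lia.
rewrite -(count_predT s); apply: leq_trans (leq_add b1 b2); rewrite !size_filter.
by apply: count_split => z /sh /andP[zI _] _; lia.
Qed.

(** If [t] is at most half the size of [X], lower the level by [3 * E], so that the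
    upper and the lower part overlap with room to spare.  Otherwise pass to
    the dual pair, whose level is less than half the size of [X]. *)
Lemma pollard_stability (X Y : seq int) (t E : nat) : (0 < E)%N -> uniq X -> uniq Y ->
  ((size X - t) * (size Y - t) <= excess X Y t + E * E)%N ->
  (80 * (75 * E) <= t)%N -> (80 * (75 * E) <= size X - t)%N ->
  (80 * (75 * E) <= size Y - t)%N ->
  (count (fun x : int => (x - 1)%R \notin X) X <= E)%N ->
  near_interval X (4 * E) (40 * (74 * E)).
Proof.
move=> E0 uX uY D Et pX pY sm; case: (leqP (2 * t) (size X)) => tX.
  apply: (@low_level_stability X Y (t - 3 * E) E) => //; try lia.
  have := @shift_level X Y t E (3 * E) uX uY D E0; nia.
have := @dual_deficit X Y t E (3 * E) uX uY D _ _ _ _ _ _ _ (erefl _) (erefl _).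
move=> dd; have lC := @popular_lower X Y t E uX uY D E0.
apply: (@low_level_stability X (negs (popular X Y t)) (size X - t - 3 * E) E) => //.
- by rewrite uniq_negs uniq_popular.
- have e16 : (16 * (E * E) = (E + 3 * E) * (E + 3 * E))%N by ring.
  by rewrite e16; apply: dd; lia.
- by lia.
- by lia.
- by rewrite size_negs; lia.
- by lia.
Qed.
(** * Lebesgue measure and grids *)

(** Monotonicity of the integral of nonnegative functions holds without any
    measurability, because the integral is a supremum over simple functions. *)
Lemma le_integral_nonneg d (T : measurableType d) (R : realType)
    (mu : {measure set T -> \bar R}) (D : set T) (f g : T -> \bar R) :
  (forall x, D x -> (0 <= f x)%E) -> (forall x, D x -> (f x <= g x)%E) ->
  (\int[mu]_(x in D) f x <= \int[mu]_(x in D) g x)%E.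
Proof.
move=> f0 fg; rewrite !ge0_integralE //; last by move=> x Dx; exact: le_trans (f0 x Dx) (fg x Dx).
apply: le_ereal_sup => _ [h hf <-]; exists h => // x; apply: le_trans (hf x) _.
rewrite !patchE; case: ifPn => // xD; apply: fg; exact: set_mem.
Qed.

Lemma vol_mono (R : realType) (A B : set R) : A `<=` B -> (vol A <= vol B)%E.
Proof. exact: (le_outer_measure (@wlength R idfun)^*%mu). Qed.

Lemma volU (R : realType) (A B : set R) : (vol (A `|` B) <= vol A + vol B)%E.
Proof. exact: (outer_measureU2 (@wlength R idfun)^*%mu). Qed.

Lemma vol_ge0 (R : realType) (A : set R) : (0 <= vol A)%E.
Proof. exact: (outer_measure_ge0 (@wlength R idfun)^*%mu). Qed.

Lemma volE (R : realType) (A : set R) : vol A = lebesgue_measure A.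
Proof. by []. Qed.

Lemma borel_caratheodory (R : realType) (A : set R) :
  measurable A -> lebesgue_measurable A.
Proof. exact: sub_caratheodory. Qed.

Definition reflection (R : realType) (x : R) : measurableTypeR R -> measurableTypeR R :=
  fun y => x - y.

Lemma measurable_reflection (R : realType) (x : R) : measurable_fun setT (@reflection R x).
Proof.
apply: continuous_measurable_fun => y.
by apply: cvgB; [exact: cvg_cst | exact: cvg_id].
Qed.

HB.instance Definition _ (R : realType) (x : R) :=
  isMeasurableFun.Build _ _ _ _ (@reflection R x) (measurable_reflection x).

Lemma vol_reflection (R : realType) (x : R) (E : set R) : measurable E ->
  vol (@reflection R x @^-1` E) = vol E.
Proof.
move=> mE; rewrite !volE.
suff -> : lebesgue_measure E = pushforward lebesgue_measure (@reflection R x) E by [].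
apply: lebesgue_measure_unique => //= _ [[a b]] _ <-.
rewrite /pushforward.
have -> : @reflection R x @^-1` [set` `]a, b]] = [set` `[x - b, x - a[].
  by apply/seteqP; split=> y /=; rewrite /reflection !in_itv /= => /andP[h1 h2]; apply/andP; split; lra.
rewrite !lebesgue_measure_itv /= !lte_fin.
have -> : (x - b < x - a) = (a < b) by lra.
by case: ifP => // _; rewrite -!EFinD; congr EFin; ring.
Qed.

(** The cells of a grid of mesh [1 / N]. *)
Definition cells (R : realType) (N : nat) (X : seq int) : set R :=
  [set x | Num.floor (N%:R * x) \in X].
Arguments cells : clear implicits.

Lemma cell_itv (R : realType) (N : nat) (n : int) : (0 < N)%N ->
  cells R N [:: n] = [set` `[n%:~R / N%:R, (n + 1)%:~R / N%:R[].
Proof.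
move=> N0; have N0' : 0 < N%:R :> R by rewrite ltr0n.
rewrite /cells; apply/seteqP; split=> x /=; rewrite mem_seq1 floor_eq in_itv /= => /andP[h1 h2].
  by rewrite ler_pdivrMr // ltr_pdivlMr // (mulrC x) h1 h2.
by move: h1 h2; rewrite ler_pdivrMr // ltr_pdivlMr // (mulrC x) => -> ->.
Qed.

Lemma cells_cons (R : realType) N n X :
  cells R N (n :: X) = cells R N [:: n] `|` cells R N X.
Proof.
rewrite /cells; apply/seteqP; split=> x /=; rewrite !inE.
  by case/orP => ->; [left|right].
by case=> ->; rewrite ?orbT.
Qed.

Lemma measurable_cells (R : realType) (N : nat) X : (0 < N)%N -> measurable (cells R N X).
Proof.
move=> N0; elim: X => [|n X IH].
  by rewrite (_ : cells _ _ _ = set0) //; apply/seteqP; split.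
by rewrite cells_cons; apply: measurableU => //; rewrite cell_itv.
Qed.

Lemma vol_cells (R : realType) (N : nat) X : (0 < N)%N -> uniq X ->
  vol (cells R N X) = ((size X)%:R / N%:R)%:E.
Proof.
move=> N0; have N0' : 0 < N%:R :> R by rewrite ltr0n.
rewrite volE; elim: X => [_|n X IH /= /andP[nX uX]].
  by rewrite (_ : cells _ _ _ = set0) ?measure0 ?mul0r //; apply/seteqP; split.
rewrite cells_cons measureU.
- rewrite [X in (_ + X)%E](IH uX) cell_itv // [X in (X + _)%E]lebesgue_measure_itv /= lte_fin ltr_pM2r ?invr_gt0 //.
  rewrite ltr_int ltrDl ltr01 -!EFinD; congr EFin.
  rewrite intrD mulrDl [X in X - _]addrC addrK -natr1 mulrDl mul1r addrC; field.
  by rewrite gt_eqF.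
- exact: measurable_cells.
- exact: measurable_cells.
- rewrite /cells; apply/seteqP; split=> // x [/=]; rewrite mem_seq1 => /eqP -> nX'.
  by rewrite nX' in nX.
Qed.

(** Up to a null set, [A] is a Borel set, to which regularity applies. *)
Lemma measurable_sandwich (R : realType) (A : set R) (e : R) :
  lebesgue_measurable A -> (vol A < +oo)%E -> 0 < e ->
  exists K U : set R,
    [/\ compact K, open U, K `<=` A, A `<=` U & (vol (U `\` K) <= e%:E)%E].
Proof.
rewrite /lebesgue_measurable -completed_caratheodory_measurable => + fA e0.
rewrite g_sigma_completed_algebra_genE => -[X mX [N [N' [mN' N'0 NN']] XN]].
have XA : X `<=` A by rewrite -XN; exact: subsetUl.
have AX : A `<=` X `|` N' by rewrite -XN; exact: setUS.
have fX : (lebesgue_measure X < +oo)%E by apply: le_lt_trans (vol_mono XA) fA.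
have fXN : (lebesgue_measure (X `|` N') < +oo)%E.
  by apply: le_lt_trans (volU X N') _; rewrite (volE N') N'0 adde0.
have e2 : 0 < e / 2 by rewrite divr_gt0.
have [K [cK KX hK]] := lebesgue_regularity_inner mX fX e2.
have [U [oU XU hU]] := lebesgue_regularity_outer (measurableU _ _ mX mN') fXN e2.
exists K, U; split=> //; first exact: subset_trans XA.
  exact: subset_trans XU.
apply: (@le_trans _ _ (vol (U `\` (X `|` N')) + (vol (X `\` K) + vol N'))%E).
  apply: le_trans (leeD (le_refl _) (volU _ _)); apply: le_trans (volU _ _).
  apply: vol_mono => x [Ux nK].
  have [[Xx|N'x]|nXN] := pselect ((X `|` N') x).
  - by right; left.
  - by right; right.
  - by left.
rewrite [X in (_ + (_ + X))%E](N'0 : vol N' = 0%E) adde0 [e]splitr EFinD.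
by apply: leeD; apply: ltW.
Qed.

(** By compactness, one radius works for all points of [K]. *)
Lemma compact_margin (R : realType) (K U : set R) : compact K -> open U -> K `<=` U ->
  exists2 r : R, 0 < r & forall x y, K x -> `|x - y| < r -> U y.
Proof.
move=> cK oU KU.
have /compact_near_coveringP /(_ R (0^'+) (fun r x => forall y, `|x - y| < r -> U y)) := cK.
case.
- move=> x Kx; have /nbhs_ballP[/= r r0 rU] : nbhs x U by apply: open_nbhs_nbhs; split=> //; exact: KU.
  have r2 : 0 < r / 2 by rewrite divr_gt0.
  exists (ball x (r / 2), [set s | s < r / 2]) => /=.
    by split; [exact: nbhsx_ballx | exact: nbhs_right_lt].
  move=> [x' s] /= [xx' sr] y x'y; apply: rU.
  rewrite /ball /= in xx' *; have := ler_distD x' x y; lra.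
move=> /= r r0 h; exists (r / 2) => //=; first by rewrite divr_gt0.
move=> x y Kx xy; apply: (h (r / 2)) => //=.
- by rewrite sub0r normrN gtr0_norm ?divr_gt0 //; lra.
- by rewrite divr_gt0.
- exact: Kx.
- exact: xy.
Qed.

(** The cells that meet [K], together with their right neighbours: these absorb the
    carry in [Num.floor (a - b)], which can be one less than
    [Num.floor a - Num.floor b]. *)
Definition hits (R : realType) (K : set R) (N : nat) (n : int) : Prop :=
  exists2 x, K x & n - 1 <= Num.floor (N%:R * x) <= n.

Lemma hits_finite (R : realType) (K : set R) (N : nat) : compact K ->
  exists X : seq int, uniq X /\ forall n, (n \in X) <-> hits K N n.
Proof.
move=> /compact_bounded[M [Mr hM]].
have hb x : K x -> `|x| <= `|M| + 1.
  by move=> Kx; apply: (hM (`|M| + 1)) => //; apply: le_lt_trans (ler_norm M) _; rewrite ltrDl.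
have [B hB] : exists B : nat, forall n, hits K N n -> `|n| <= B%:Z.
  exists (`|Num.floor (N%:R * (`|M| + 1))| + 2)%N => n [x Kx /andP[h1 h2]].
  have /ler_normlP[x1 x2] := hb x Kx.
  have N0 : 0 <= N%:R :> R by [].
  have l1 : Num.floor (N%:R * x) <= Num.floor (N%:R * (`|M| + 1)).
    by apply: le_floor; apply: ler_wpM2l.
  have l2 : - Num.floor (N%:R * (`|M| + 1)) - 1 <= Num.floor (N%:R * x).
    rewrite floor_ge_int; apply: (@le_trans _ _ (N%:R * (- (`|M| + 1)))); last first.
      by apply: ler_wpM2l => //; lra.
    have := floorD1_gt (N%:R * (`|M| + 1)); rewrite mulrN rmorphB rmorphN /= intrD; lra.
  lia.
exists [seq n <- [seq (i%:Z - B%:Z) | i <- iota 0 (B + B).+1] | `[< hits K N n >]].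
split=> [|n].
  by rewrite filter_uniq // map_inj_uniq ?iota_uniq // => i j; lia.
rewrite mem_filter; split=> [/andP[/asboolP] //|h]; apply/andP; split; first exact/asboolP.
apply/mapP; exists (absz (n + B%:Z)%R); last by have := hB n h; lia.
by rewrite mem_iota; have := hB n h; lia.
Qed.

Lemma floor_dist (R : realType) (N : nat) (x y : R) : (0 < N)%N ->
  `|Num.floor (N%:R * x) - Num.floor (N%:R * y)| <= 1 -> `|x - y| < 2 / N%:R.
Proof.
move=> N0 h; have N0' : 0 < N%:R :> R by rewrite ltr0n.
rewrite ltr_pdivlMr // -{1}(ger0_norm (ltW N0')) -normrM mulrBl (mulrC x) (mulrC y).
have /andP[a1 a2] := floor_itv (N%:R * x); have /andP[b1 b2] := floor_itv (N%:R * y).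
have h1 : (Num.floor (N%:R * x))%:~R <= (Num.floor (N%:R * y))%:~R + 1 :> R.
  by rewrite -[X in _ <= _ + X]/(1%:~R) -intrD ler_int; lia.
have h2 : (Num.floor (N%:R * y))%:~R <= (Num.floor (N%:R * x))%:~R + 1 :> R.
  by rewrite -[X in _ <= _ + X]/(1%:~R) -intrD ler_int; lia.
rewrite !intrD in a2 b2.
by rewrite ltr_norml; apply/andP; split; lra.
Qed.

(** Discretization: for a fine grid, the finite set of the cells near [K]
    approximates [A] and has few left endpoints, since a cell that is missed just
    to the left of a cell near [K] lies in the small set [U `\` K]. *)
Lemma discretize (R : realType) (A : set R) (e : R) :
  lebesgue_measurable A -> (vol A < +oo)%E -> 0 < e ->
  exists (K U : set R) (N0 : nat),
    [/\ measurable (U `\` K), K `<=` A, A `<=` U & (vol (U `\` K) <= e%:E)%E] /\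
    forall N : nat, (N0 <= N)%N -> (0 < N)%N -> exists X : seq int,
      [/\ uniq X, forall n, (n \in X) <-> hits K N n,
          K `<=` cells R N X, cells R N X `<=` U &
          (count (fun x : int => (x - 1)%R \notin X) X)%:R <= e * N%:R].
Proof.
move=> mA fA e0; have [K [U [cK oU KA AU UK]]] := measurable_sandwich mA fA e0.
have mUK : measurable (U `\` K).
  apply: measurableD; first exact: open_measurable.
  by apply: closed_measurable; exact: compact_closed cK.
have [r r0 rU] := compact_margin cK oU (subset_trans KA AU).
exists K, U, (Num.bound (2 / r)).+1; split=> // N hN N0.
have N0' : 0 < N%:R :> R by rewrite ltr0n.
have Nr : 2 / N%:R < r.
  have h1 : 2 / r < N%:R.
    apply: lt_trans (archi_boundP _) _; first by rewrite divr_ge0 // ltW.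
    by rewrite ltr_nat.
  by move: h1; rewrite ltr_pdivrMr // ltr_pdivrMr // mulrC.
have [X [uX hX]] := @hits_finite R K N cK.
have near (x y : R) : K x -> `|Num.floor (N%:R * x) - Num.floor (N%:R * y)| <= 1 -> U y.
  by move=> Kx h; apply: (rU x y Kx); apply: lt_trans (floor_dist N0 h) Nr.
exists X; split=> //.
- by move=> x Kx; apply/hX; exists x => //; rewrite lexx lerBlDr lerDl.
- move=> y /hX [x Kx]; move=> h; apply: (near x) => //; move: h.
  by move: (Num.floor (N%:R * x)) (Num.floor (N%:R * y)) => a b; lia.
(* The cells just to the left of the runs of [X] are missed by [K]. *)
pose L := [seq x - 1 | x <- X & (x - 1)%R \notin X].
have uL : uniq L by rewrite map_inj_uniq ?filter_uniq // => x y; lia.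
have sL : size L = count (fun x : int => (x - 1)%R \notin X) X by rewrite size_map size_filter.
have LU : cells R N L `<=` U `\` K.
  move=> y /mapP[n]; rewrite mem_filter => /andP[n1 /hX [x Kx h]] yn; split.
    have nx : Num.floor (N%:R * x) != n - 1.
      apply/eqP => e1; move/negP: n1; apply; apply/hX; exists x => //.
      by rewrite e1 lexx lerBlDr lerDl.
    apply: (near x) => //; move: nx h yn.
    by move: (Num.floor (N%:R * x)) (Num.floor (N%:R * y)) => a b; lia.
  move=> Ky; move/negP: n1; apply; apply/hX; exists y => //; rewrite yn.
  by rewrite lexx lerBlDr lerDl.
have := le_trans (vol_mono LU) UK.
by rewrite vol_cells // sL lee_fin ler_pdivrMr.
Qed.
(** * Discretization of the convolution *)

Lemma floorB_bounds (R : realType) (a b : R) :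
  Num.floor a - Num.floor b - 1 <= Num.floor (a - b) <= Num.floor a - Num.floor b.
Proof.
have /andP[a1 a2] := floor_itv a; have /andP[b1 b2] := floor_itv b.
rewrite !intrD in a2 b2; apply/andP; split.
  by rewrite floor_ge_int !rmorphB /=; lra.
by rewrite -ltzD1 floor_lt_int intrD !rmorphB /=; lra.
Qed.

(** The convolution is controlled by the number of representations on the
    grid: up to the two small error sets, [y] contributes at [x] only if its
    cell and a cell near [x - y] are both listed. *)
Lemma convolution_le (R : realType) (A B KA UA KB UB : set R) (e : R) (N : nat)
    (X Y : seq int) (x : R) : (0 < N)%N -> uniq X ->
  measurable (UA `\` KA) -> A `<=` UA -> (vol (UA `\` KA) <= e%:E)%E ->
  measurable (UB `\` KB) -> B `<=` UB -> (vol (UB `\` KB) <= e%:E)%E ->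
  KA `<=` cells R N X -> (forall n, hits KB N n -> n \in Y) ->
  convolution \1_A \1_B x <= (rep X Y (Num.floor (N%:R * x)))%:R / N%:R + 2 * e.
Proof.
move=> N0 uX mA AU eA mB BU eB KX KY.
have N0' : 0 < N%:R :> R by rewrite ltr0n.
have e0 : 0 <= e by rewrite -lee_fin; apply: le_trans eA; exact: vol_ge0.
set n := Num.floor (N%:R * x).
pose Z := [seq i <- X | n - i \in Y].
pose D := (UA `\` KA) `|` (@reflection R x @^-1` (UB `\` KB) `|` cells R N Z).
have mD : measurable D.
  apply: measurableU => //; apply: measurableU; last exact: measurable_cells.
  by rewrite -[X in measurable X]setTI; apply: measurable_reflection.
have volD : (vol D <= ((rep X Y n)%:R / N%:R + 2 * e)%:E)%E.
  apply: le_trans (volU _ _) _.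
  apply: (@le_trans _ _ (e%:E + (e%:E + ((rep X Y n)%:R / N%:R)%:E))%E).
    apply: leeD => //; apply: le_trans (volU _ _) _; apply: leeD.
      by rewrite vol_reflection.
    by rewrite vol_cells ?filter_uniq // size_filter.
  by rewrite -!EFinD lee_fin; lra.
have int : (\int[@completed_lebesgue_measure R]_y (\1_A y * \1_B (x - y))%:E <= vol D)%E.
  have -> : vol D = (\int[@completed_lebesgue_measure R]_y (\1_D y)%:E)%E.
    by rewrite integral_indic ?setIT //; exact: borel_caratheodory.
  apply: le_integral_nonneg => y _; first by rewrite lee_fin !indicE.
  rewrite lee_fin !indicE.
  case: (boolP (y \in A)) => [/set_mem Ay|_]; last by rewrite mul0r.
  case: (boolP (x - y \in B)) => [/set_mem By|_]; last by rewrite mulr0.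
  rewrite mem_set ?mulr1 //.
  have [KAy|nA] := pselect (KA y); last by left; split=> //; exact: AU.
  have [KBy|nB] := pselect (KB (x - y)); last by right; left; split=> //; exact: BU.
  right; right; rewrite /cells /= mem_filter; apply/andP; split; last exact: KX.
  apply: KY; exists (x - y) => //; rewrite mulrBr /n.
  exact: floorB_bounds.
have int0 : (0 <= \int[@completed_lebesgue_measure R]_y (\1_A y * \1_B (x - y))%:E)%E.
  by apply: integral_ge0 => y _; rewrite lee_fin !indicE.
rewrite /convolution /Rintegral -lee_fin fineK; first exact: le_trans int volD.
by rewrite ge0_fin_numE //; apply: le_lt_trans (le_trans int volD) _; rewrite ltry.
Qed.

(** On each cell the convolution is bounded by a constant [c z], so that the
    integral of the measures of the superlevel sets is at most a sum of lengths
    of intervals from [tau] to [c z]. *)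
Lemma superlevel_integral_le (R : realType) (A B : set R) (d tau : R) (N t : nat)
    (X Y : seq int) : (0 < N)%N ->
  (forall x, convolution \1_A \1_B x <= (rep X Y (Num.floor (N%:R * x)))%:R / N%:R + d) ->
  t%:R / N%:R <= tau - d ->
  (\int[@completed_lebesgue_measure R]_(s in `[tau, +oo[) vol (superlevel A B s)
    <= ((excess X Y t)%:R / N%:R ^+ 2)%:E)%E.
Proof.
move=> N0 hc ht; have N0' : 0 < N%:R :> R by rewrite ltr0n.
pose c (z : int) : R := (rep X Y z)%:R / N%:R + d.
pose f (z : int) (s : R) : \bar R := (\1_[set s | s < c z] s)%:E.
have level s : s >= tau -> (vol (superlevel A B s) <=
    (N%:R^-1)%:E * \sum_(z <- sumset X Y) f z s)%E.
  move=> st; pose P := [seq z <- sumset X Y | s < c z].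
  have SP : superlevel A B s `<=` cells R N P.
    move=> x; rewrite /superlevel /= => hx.
    have lt := lt_le_trans hx (hc x); rewrite /cells /= mem_filter; apply/andP; split=> //.
    have : (t < rep X Y (Num.floor (N%:R * x)))%N.
      rewrite -(ltr_nat R) -(@ltr_pM2r _ (N%:R^-1)) ?invr_gt0 //; lra.
    by rewrite -mem_popular mem_filter => /andP[].
  apply: le_trans (vol_mono SP) _.
  rewrite vol_cells ?filter_uniq ?undup_uniq // size_filter -sum1_count natr_sum mulrC.
  rewrite EFinM lee_pmul2l ?lte_fin ?invr_gt0 // big_mkcond sumEFin lee_fin.
  by apply: ler_sum => z _; rewrite indicE; case: ifPn => // h; rewrite mem_set.
have mS z : measurable [set s | s < c z].
  by rewrite -set_itvNyo.
have cS z := borel_caratheodory (mS z).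
have mI : lebesgue_measurable [set` `[tau, +oo[] by exact: borel_caratheodory.
apply: (@le_trans _ _ (\int[@completed_lebesgue_measure R]_(s in `[tau, +oo[)
    ((N%:R^-1)%:E * \sum_(z <- sumset X Y) f z s))%E).
  apply: le_integral_nonneg => s; first by move=> _; exact: vol_ge0.
  by rewrite /= in_itv /= andbT; exact: level.
pose T := caratheodory_type ((@wlength R idfun)^*)%mu.
have mf z : measurable_fun ([set` `[tau, +oo[] : set T) (f z : T -> \bar R).
  apply/measurable_EFinP; apply: measurable_indic; exact: cS.
have f0 z s : (0 <= f z s)%E by rewrite lee_fin indicE.
have mF : measurable_fun ([set` `[tau, +oo[] : set T)
    (fun s : T => \sum_(z <- sumset X Y) f z s)%E.
  exact: emeasurable_sum.
have F0 s : (0 <= \sum_(z <- sumset X Y) f z s)%E by apply: sume_ge0.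
have N0V : 0 <= N%:R^-1 :> R by rewrite invr_ge0 ltW.
have -> : (\int[@completed_lebesgue_measure R]_(s in `[tau, +oo[)
    ((N%:R^-1)%:E * \sum_(z <- sumset X Y) f z s) =
  (N%:R^-1)%:E * \sum_(z <- sumset X Y)
    \int[@completed_lebesgue_measure R]_(s in `[tau, +oo[) f z s)%E.
  rewrite -ge0_integral_sum; [|exact: mI|exact: mf|by move=> z s _; exact: f0].
  apply: ge0_integralZl_EFin; [exact: mI| |exact: mF|exact: N0V].
  by move=> s _; exact: F0.
rewrite expr2 invfM mulrA mulrC EFinM lee_pmul2l ?lte_fin ?invr_gt0 //.
rewrite natr_sum mulr_suml -sumEFin; apply: lee_sum => z _.
rewrite integral_indic; [|exact: mI|exact: cS].
apply: (@le_trans _ _ (vol [set` `[tau, c z[])).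
  by apply: vol_mono => s /= [h1]; rewrite !in_itv /= andbT => ->.
rewrite volE lebesgue_measure_itv /= lte_fin; case: ifPn => [h|_]; last first.
  by rewrite lee_fin mulr_ge0.
rewrite -EFinB lee_fin /c.
have : (rep X Y z)%:R <= (rep X Y z - t)%:R + t%:R :> R.
  by rewrite -natrD ler_nat; lia.
move=> /(ler_wpM2r N0V); rewrite mulrDl => h1; lra.
Qed.
(** * From the grid back to the line *)

(** A point of the symmetric difference lies in [U `\` K], in a listed cell
    outside the interval, or in a hole. *)
Lemma interval_of_near (R : realType) (A K U : set R) (e : R) (N a b : nat)
    (X : seq int) : (0 < N)%N -> uniq X -> K `<=` A -> A `<=` U ->
  (vol (U `\` K) <= e%:E)%E -> K `<=` cells R N X -> cells R N X `<=` U ->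
  near_interval X a b ->
  exists I : interval R, (vol (A `+` [set` I]) <= (e + (a + b)%:R / N%:R)%:E)%E.
Proof.
move=> N0 uX KA AU eUK KX XU [lo [hi [out ho]]].
have N0' : 0 < N%:R :> R by rewrite ltr0n.
exists `[lo%:~R / N%:R, (hi + 1)%:~R / N%:R[.
pose O := [seq x <- X | ~~ (lo <= x <= hi)%R].
pose H := [seq z <- [seq lo + i%:Z | i <- iota 0 (absz (hi + 1 - lo)%R)] |
   (lo <= z <= hi)%R && (z \notin X)].
have uO : uniq O by rewrite filter_uniq.
have uH : uniq H by rewrite filter_uniq // map_inj_uniq ?iota_uniq // => i j; lia.
have sO : (size O <= a)%N by rewrite size_filter.
have sH : (size H <= b)%N by apply: ho => // z; rewrite mem_filter => /andP[].
apply: (@le_trans _ _ (vol (U `\` K) + (vol (cells R N O) + vol (cells R N H)))%E).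
  apply: le_trans (leeD (le_refl _) (volU _ _)); apply: le_trans (volU _ _).
  apply: vol_mono => x.
  have inI : [set` `[lo%:~R / N%:R, (hi + 1)%:~R / N%:R[] x =
      (lo <= Num.floor (N%:R * x) <= hi) :> Prop.
    rewrite /= in_itv /= ler_pdivrMr // ltr_pdivlMr // (mulrC x).
    by rewrite -floor_ge_int -floor_lt_int ltzD1.
  case=> -[]; rewrite inI => h1 h2.
    have [xX|nX] := boolP (Num.floor (N%:R * x) \in X).
      by right; left; rewrite /cells /= mem_filter xX andbT; apply/negP.
    by left; split; [exact: AU | move=> /KX; exact/negP].
  have [xX|nX] := boolP (Num.floor (N%:R * x) \in X).
    by left; split; [exact: XU | move=> /KA].
  right; right; rewrite /cells /= mem_filter h1 nX /=.
  apply/mapP; exists `|Num.floor (N%:R * x) - lo|%N; first rewrite mem_iota.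
    by move: h1; move: (Num.floor _) => k; lia.
  by move: h1; move: (Num.floor _) => k; lia.
rewrite !vol_cells // -!EFinD; apply: le_trans (leeD eUK (le_refl _)) _.
rewrite -EFinD lee_fin lerD2l -mulrDl ler_pM2r ?invr_gt0 // -natrD ler_nat.
exact: leq_add.
Qed.

Lemma rvolK (R : realType) (A : set R) : (vol A < +oo)%E -> (rvol A)%:E = vol A.
Proof. by move=> fA; rewrite /rvol fineK // ge0_fin_numE // vol_ge0. Qed.

Lemma size_near_vol (R : realType) (A K U : set R) (e : R) (N : nat) (X : seq int) :
  (0 < N)%N -> uniq X -> (vol A < +oo)%E -> K `<=` A -> A `<=` U ->
  (vol (U `\` K) <= e%:E)%E -> K `<=` cells R N X -> cells R N X `<=` U ->
  rvol A - e <= (size X)%:R / N%:R <= rvol A + e.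
Proof.
move=> N0 uX fA KA AU eUK KX XU; apply/andP; split.
  rewrite lerBlDr -lee_fin EFinD rvolK // -vol_cells //.
  apply: le_trans (leeD (le_refl _) eUK); apply: le_trans (volU _ _).
  apply: vol_mono => x Ax; have [Kx|nK] := pselect (K x); [left|right].
    exact: KX.
  by split=> //; exact: AU.
rewrite -lee_fin EFinD rvolK // -vol_cells //.
apply: le_trans (leeD (le_refl _) eUK); apply: le_trans (volU _ _).
apply: vol_mono => x /XU Ux; have [Kx|nK] := pselect (K x); [left|right] => //.
exact: KA.
Qed.

(** With summable errors, the lower limit of the approximating intervals agrees with
    [A] up to a null set, and a lower limit of intervals is an interval. *)
Lemma interval_limit (R : realType) (A : set R) :
  (forall e : R, 0 < e -> exists I : interval R, (vol (A `+` [set` I]) <= e%:E)%E) ->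
  exists I : interval R, (vol (A `+` [set` I]) <= 0)%E.
Proof.
move=> h; pose e (n : nat) : R := (2 ^+ n)^-1.
have e0 n : 0 < e n by rewrite invr_gt0 exprn_gt0.
have [J hI] := choice (fun n => h (e n) (e0 n)).
(* The lower limit of the intervals [J n], an increasing union of intervals. *)
pose L := \bigcup_n \bigcap_k [set` J (n + k)%N].
have iL : is_interval L.
  move=> x y [n _ Hn] [m _ Hm] z xzy; exists (maxn n m) => // k _.
  have Hx : [set` J (maxn n m + k)%N] x.
    have := Hn (maxn n m + k - n)%N Logic.I; rewrite subnKC; first by apply.
    by rewrite (leq_trans (leq_maxl n m)) // leq_addr.
  have Hy : [set` J (maxn n m + k)%N] y.
    have := Hm (maxn n m + k - m)%N Logic.I; rewrite subnKC; first by apply.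
    by rewrite (leq_trans (leq_maxr n m)) // leq_addr.
  exact: (@interval_is_interval _ (J (maxn n m + k)%N) x y Hx Hy z xzy).
exists (Rhull L); rewrite -(is_intervalP _).1 //.
have small (S : set R) : (forall n, (vol S <= (e n)%:E)%E) -> (vol S <= 0)%E.
  move=> hS; apply/lee_addgt0Pr => r r0; rewrite add0e.
  pose n := Num.bound (r^-1); apply: le_trans (hS n) _; rewrite lee_fin /e.
  rewrite -[leRHS]invrK lef_pV2 ?posrE ?exprn_gt0 ?invr_gt0 //.
  apply: le_trans (ltW (archi_boundP _)) _; first by rewrite invr_ge0 ltW.
  by rewrite -natrX ler_nat ltnW // ltn_expl.
have subA (F : nat -> set R) : (vol (\bigcup_n F n) <= \sum_(0 <= n <oo) vol (F n))%E.
  exact: (outer_measure_sigma_subadditive (@wlength R idfun)^*%mu).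
have hIl n : (vol (A `\` [set` J n]) <= (e n)%:E)%E.
  by apply: le_trans (hI n); apply: vol_mono; left.
have hIr n : (vol ([set` J n] `\` A) <= (e n)%:E)%E.
  by apply: le_trans (hI n); apply: vol_mono; right.
have left_part : (vol (A `\` L) <= 0)%E.
  apply: small => n.
  apply: (@le_trans _ _ (vol (\bigcup_k (A `\` [set` J (n.+1 + k)%N])))).
    apply: vol_mono => x [Ax nL]; apply: contrapT => nU; apply: nL.
    by exists n.+1 => // k _; apply: contrapT => nI; apply: nU; exists k.
  apply: le_trans (subA _) _.
  apply: le_trans (_ : (\sum_(0 <= k <oo) (e n / (2 ^ k.+1)%:R)%:E <= _)%E).
    apply: lee_nneseries => [k _ _|k _]; first exact: vol_ge0.
    apply: le_trans (hIl _) _; rewrite lee_fin /e natrX -invfM -exprD.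
    by rewrite addSnnS.
  by apply: epsilon_trick0; exact: ltW.
have right_part : (vol (L `\` A) <= 0)%E.
  apply: (@le_trans _ _ (vol (\bigcup_n ((\bigcap_k [set` J (n + k)%N]) `\` A)))).
    by apply: vol_mono => x [[n _ Ln] nA]; exists n.
  apply: le_trans (subA _) _; rewrite eseries0 // => n _ _.
  apply/eqP; rewrite eq_le vol_ge0 andbT; apply: small => k.
  apply: le_trans (_ : (vol ([set` J (n + k)%N] `\` A) <= _)%E).
    by apply: vol_mono => x [Lx nA]; split=> //; exact: Lx.
  apply: le_trans (hIr _) _; rewrite lee_fin /e lef_pV2 ?posrE ?exprn_gt0 //.
  by rewrite ler_weXn2l ?ler1n // leq_addl.
apply: le_trans (volU _ _) _; rewrite -[0%E]adde0; exact: leeD.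
Qed.
(** The error [e] of the discretization perturbs the deficit by a multiple of
    [e], which is below [s ^+ 2] if [e] is small. *)
Lemma deficit_perturbation (R : realFieldType) (a b tau rho s e q : R) :
  0 <= rho -> 0 < s -> 0 < e -> e <= 1 -> 0 <= tau ->
  e * (4 * (a + b) + 16) <= s ^+ 2 -> (a - tau) * (b - tau) <= rho ^+ 2 + q ->
  (a - tau + 4 * e) * (b - tau + 4 * e) <= q + (rho + s) * (rho + s).
Proof.
move=> rho0 s0 e0 e1 tau0 eM hq.
have h1 : e * e <= e by rewrite ler_piMr // ltW.
have h2 : 0 <= rho * s by rewrite mulr_ge0 // ltW.
have h3 : 0 <= e * tau by rewrite mulr_ge0 // ltW.
lra.
Qed.

(** The discrete theorem with [E / N] between [rho + s] and [rho + 2 * s], where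
    [rho] bounds the square root of the deficit and the arbitrary [s] leaves room
    for the errors of the discretization. *)
Lemma near_intervals (R : realType) (A B : set R) (tau rho s : R) :
  lebesgue_measurable A -> lebesgue_measurable B ->
  (vol A < +oo)%E -> (vol B < +oo)%E ->
  0 <= rho -> deficit A B tau <= rho ^+ 2 -> 0 < s ->
  80 * (75 * rho) + 80 * (151 * s) <= tau ->
  80 * (75 * rho) + 80 * (151 * s) <= rvol A - tau ->
  80 * (75 * rho) + 80 * (151 * s) <= rvol B - tau ->
  exists I J : interval R,
    (vol (A `+` [set` I]) <= (40 * (75 * rho) + 80 * (75 * s))%:E)%E /\
    (vol (B `+` [set` J]) <= (40 * (75 * rho) + 80 * (75 * s))%:E)%E.
Proof.
move=> mA mB fA fB rho0 hd s0 htau ha hb.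
set a := rvol A in ha *; set b := rvol B in hb *.
have a0 : 0 < a by nra.
have b0 : 0 < b by nra.
pose M := 4 * (a + b) + 16.
have M0 : 0 < M by rewrite /M; lra.
pose e := Num.min (Num.min s 1) (s ^+ 2 / M).
have e0 : 0 < e by rewrite /e !lt_min s0 ltr01 divr_gt0 ?exprn_gt0.
have es : e <= s by rewrite /e !ge_min lexx.
have e1 : e <= 1 by rewrite /e !ge_min lexx orbT.
have eM : e * M <= s ^+ 2 by rewrite -ler_pdivlMr // /e ge_min lexx orbT.
have [KA [UA [NA [[mUKA KA_A A_UA eA] hA]]]] := discretize mA fA e0.
have [KB [UB [NB [[mUKB KB_B B_UB eB] hB]]]] := discretize mB fB e0.
have [N [NA_N NB_N N0 Ne]] : exists N : nat,
    [/\ (NA <= N)%N, (NB <= N)%N, (0 < N)%N & 1 <= e * N%:R].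
  exists (maxn (maxn NA NB) (Num.bound e^-1)).+1; split=> //.
  - by rewrite leqW // (leq_trans (leq_maxl NA NB)) // leq_maxl.
  - by rewrite leqW // (leq_trans (leq_maxr NA NB)) // leq_maxl.
  rewrite mulrC -ler_pdivrMr // mul1r; apply: le_trans (ltW (archi_boundP _)) _.
    by rewrite invr_ge0 ltW.
  by rewrite ler_nat leqW // leq_maxr.
have [X [uX hX KX XU smX]] := hA N NA_N N0.
have [Y [uY hY KY YU smY]] := hB N NB_N N0.
have N0' : 0 < N%:R :> R by rewrite ltr0n.
have /andP[x1 x2] := size_near_vol N0 uX fA KA_A A_UA eA KX XU.
have /andP[y1 y2] := size_near_vol N0 uY fB KB_B B_UB eB KY YU.
rewrite -/a -/b in x1 x2 y1 y2.
rewrite ler_pdivlMr // in x1; rewrite ler_pdivlMr // in y1.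
rewrite ler_pdivrMr // in x2; rewrite ler_pdivrMr // in y2.
have te : 0 <= N%:R * (tau - 2 * e) by apply: mulr_ge0; [exact: ltW|lra].
have [t [t1 t2]] : exists t : nat, t%:R <= N%:R * (tau - 2 * e) /\ N%:R * (tau - 3 * e) <= t%:R.
  exists (Num.trunc (N%:R * (tau - 2 * e))); have /andP[-> h] := truncn_itv te; split=> //.
  by rewrite -natr1 in h; lra.
have Es : 0 <= N%:R * (rho + s) by apply: mulr_ge0; [exact: ltW|lra].
have [E [E0 E1 E2]] : exists E : nat, [/\ (0 < E)%N, N%:R * (rho + s) <= E%:R &
    E%:R <= N%:R * (rho + 2 * s)].
  exists (Num.trunc (N%:R * (rho + s))).+1; have /andP[h1 h2] := truncn_itv Es.
  by split=> //; [exact: ltW | rewrite -natr1; nra].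
have sN : e * N%:R <= s * N%:R by rewrite ler_pM2r.
have tX : (t <= size X)%N by rewrite -(ler_nat R); nra.
have tY : (t <= size Y)%N by rewrite -(ler_nat R); nra.
have Et : (80 * (75 * E) <= t)%N by rewrite -(ler_nat R) !natrM; nra.
have EX : (80 * (75 * E) <= size X - t)%N by rewrite -(ler_nat R) natrB // !natrM; nra.
have EY : (80 * (75 * E) <= size Y - t)%N by rewrite -(ler_nat R) natrB // !natrM; nra.
have sX : (count (fun x : int => (x - 1)%R \notin X) X <= E)%N.
  by rewrite -(ler_nat R); apply: le_trans smX _; nra.
have sY : (count (fun x : int => (x - 1)%R \notin Y) Y <= E)%N.
  by rewrite -(ler_nat R); apply: le_trans smY _; nra.
have tN : t%:R / N%:R <= tau - 2 * e by rewrite ler_pdivrMr // mulrC.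
have conv x := convolution_le x N0 uX mUKA A_UA eA mUKB B_UB eB KX (fun n => (hY n).2).
have hint := superlevel_integral_le N0 conv tN.
have hint0 : (0 <= \int[@completed_lebesgue_measure R]_(s in `[tau, +oo[)
    vol (superlevel A B s))%E by apply: integral_ge0 => x _; exact: vol_ge0.
have hfine : fine (\int[@completed_lebesgue_measure R]_(s in `[tau, +oo[)
    vol (superlevel A B s))%E <= (excess X Y t)%:R / N%:R ^+ 2.
  rewrite -lee_fin fineK // ge0_fin_numE //.
  by apply: le_lt_trans hint _; rewrite ltry.
have D : ((size X - t) * (size Y - t) <= excess X Y t + E * E)%N.
  rewrite -(ler_nat R) natrD !natrM !natrB //.
  move: hd; rewrite /deficit -/a -/b => hd.
  have hex : (a - tau) * (b - tau) <= rho ^+ 2 + (excess X Y t)%:R / N%:R ^+ 2.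
    by clear -hd hfine; lra.
  have hprod : ((size X)%:R - t%:R) * ((size Y)%:R - t%:R) <=
      (N%:R * (a - tau + 4 * e)) * (N%:R * (b - tau + 4 * e)) :> R.
    by clear -tX tY x2 y2 t2; apply: ler_pM; rewrite ?subr_ge0 ?ler_nat //; lra.
  apply: le_trans hprod _.
  have hEE : (N%:R * (rho + s)) * (N%:R * (rho + s)) <= E%:R * E%:R :> R.
    by apply: ler_pM.
  apply: le_trans (lerD (le_refl _) hEE).
  have hexN : (excess X Y t)%:R = N%:R ^+ 2 * ((excess X Y t)%:R / N%:R ^+ 2) :> R.
    by field; rewrite gt_eqF.
  rewrite hexN; move: ((excess X Y t)%:R / N%:R ^+ 2) hex => q hex.
  have tau0 : 0 <= tau by clear -htau rho0 s0; lra.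
  have key := deficit_perturbation rho0 s0 e0 e1 tau0 eM hex.
  have N2 : 0 <= N%:R ^+ 2 :> R by rewrite exprn_ge0 // ltW.
  by have := ler_wpM2l N2 key; clear; lra.
have D' : ((size Y - t) * (size X - t) <= excess Y X t + E * E)%N.
  by rewrite excess_sym // mulnC.
have nX := pollard_stability E0 uX uY D Et EX EY sX.
have nY := pollard_stability E0 uY uX D' Et EY EX sY.
have [I hI] := interval_of_near N0 uX KA_A A_UA eA KX XU nX.
have [J hJ] := interval_of_near N0 uY KB_B B_UB eB KY YU nY.
have last : e + (4 * E + 40 * (74 * E))%:R / N%:R <= 40 * (75 * rho) + 80 * (75 * s).
  have : E%:R / N%:R <= rho + 2 * s by rewrite ler_pdivrMr // mulrC.
  by clear -es rho0 s0; rewrite natrD !natrM; lra.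
exists I, J; split; [apply: le_trans hI _ | apply: le_trans hJ _]; by rewrite lee_fin.
Qed.

Theorem theorem13p1 (R : realType) (eta : R) (heta : 0 < eta <= 2^-1) :
  exists K : R, 0 < K /\
    forall A B : set R,
      lebesgue_measurable A -> lebesgue_measurable B ->
      (0 < vol A < +oo)%E -> (0 < vol B < +oo)%E ->
      Num.min (rvol A) (rvol B)
        >= eta * (1 - eta)^-1 * Num.max (rvol A) (rvol B) ->
    forall tau : R,
      eta * Num.max (rvol A) (rvol B) <= tau
        <= (1 - eta) * Num.min (rvol A) (rvol B) ->
      deficit A B tau <
        Num.min (tau ^+ 2)
          (Num.min ((rvol B - tau) ^+ 2)
             (K^-1 * eta ^+ 8 * Num.max (rvol A) (rvol B) ^+ 2)) ->
    exists I J : interval R,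
      (vol (A `+` [set` I]) <= (K * Num.sqrt (deficit A B tau))%:E)%E /\
      (vol (B `+` [set` J]) <= (K * Num.sqrt (deficit A B tau))%:E)%E.
Proof.
have /andP[eta0 eta2] := heta.
(* [80 * 75] is the factor by which [pollard_stability] requires the sizes to
   exceed [E]; the deficit scales like [E ^ 2]. *)
exists ((80 * 75) ^+ 2); split; first by rewrite exprn_gt0 // mulr_gt0.
move=> A B mA mB /andP[A0 fA] /andP[B0 fB] hmin tau /andP[tau1 tau2] hd.
set a := rvol A in hmin tau1 tau2 hd *; set b := rvol B in hmin tau1 tau2 hd *.
set m := Num.min a b in hmin tau2; set M := Num.max a b in hmin tau1 hd.
have a0 : 0 < a by rewrite -lte_fin rvolK.
have b0 : 0 < b by rewrite -lte_fin rvolK.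
have M0 : 0 < M by rewrite lt_max a0.
have ma : m <= a by rewrite ge_min lexx.
have mb : m <= b by rewrite ge_min lexx orbT.
have etaM : eta ^+ 2 * M <= eta * m.
  rewrite expr2 -mulrA ler_pM2l //; apply: le_trans hmin.
  rewrite ler_pM2r // ler_peMr ?(ltW eta0) // invf_ge1; lra.
set rho := Num.sqrt (deficit A B tau).
have rho0 : 0 <= rho by exact: sqrtr_ge0.
have hrho : deficit A B tau <= rho ^+ 2.
  have [d0|d0] := lerP 0 (deficit A B tau); first by rewrite sqr_sqrtr.
  by apply: le_trans (ltW d0) _; rewrite exprn_ge0.
have small : 80 * (75 * rho) < eta ^+ 2 * M.
  have e2M : 0 < eta ^+ 2 * M by rewrite mulr_gt0 // exprn_gt0.
  have pos : 0 <= 80 * (75 * rho) by rewrite !mulr_ge0.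
  rewrite -(@ltr_pXn2r _ 2) ?nnegrE ?(ltW e2M) //.
  have [d0|d0] := lerP (deficit A B tau) 0.
    by rewrite /rho ler0_sqrtr // !mulr0 expr0n /= exprn_gt0.
  rewrite mulrA exprMn sqr_sqrtr ?(ltW d0) //.
  have : deficit A B tau < ((80 * 75) ^+ 2)^-1 * eta ^+ 8 * M ^+ 2.
    by apply: lt_le_trans hd _; rewrite !ge_min lexx !orbT.
  rewrite -mulrA -ltr_pdivrMl ?invr_gt0 ?exprn_gt0 ?mulr_gt0 // invrK => /lt_le_trans; apply.
  rewrite exprMn -exprM ler_pM2r ?exprn_gt0 //.
  by apply: ler_wiXn2l => //; lra.
have htau : 80 * (75 * rho) < tau.
  apply: lt_le_trans small _; apply: le_trans tau1; rewrite ler_pM2r // expr2 ler_piMr ?(ltW eta0) //.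
  lra.
have ham : 80 * (75 * rho) < m - tau.
  by apply: lt_le_trans small _; lra.
pose g := Num.min (tau - 80 * (75 * rho)) (m - tau - 80 * (75 * rho)).
have g0 : 0 < g by rewrite lt_min; apply/andP; split; lra.
have g1 : g <= tau - 80 * (75 * rho) by rewrite ge_min lexx.
have g2 : g <= m - tau - 80 * (75 * rho) by rewrite ge_min lexx orbT.
have appr s : 0 < s -> exists I J : interval R,
    (vol (A `+` [set` I]) <= (40 * (75 * rho) + s)%:E)%E /\
    (vol (B `+` [set` J]) <= (40 * (75 * rho) + s)%:E)%E.
  move=> s0; pose s' := Num.min s g / (80 * 151).
  have c0 : 0 < 80 * 151 :> R by rewrite mulr_gt0.
  have s'0 : 0 < s' by rewrite divr_gt0 // lt_min s0.
  have es' : 80 * (151 * s') = Num.min s g by rewrite mulrA mulrC divfK // gt_eqF.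
  have h1 : 80 * (151 * s') <= s by rewrite es' ge_min lexx.
  have h2 : 80 * (151 * s') <= g by rewrite es' ge_min lexx orbT.
  have [| | | I [J [hI hJ]]] := @near_intervals R A B tau rho s' mA mB fA fB rho0 hrho s'0.
  - by clear -h2 g1; lra.
  - by rewrite -/a; clear -h2 g2 ma; lra.
  - by rewrite -/b; clear -h2 g2 mb; lra.
  have le_s : 40 * (75 * rho) + 80 * (75 * s') <= 40 * (75 * rho) + s.
    by clear -h1 s'0; lra.
  by exists I, J; split; [apply: le_trans hI _|apply: le_trans hJ _]; rewrite lee_fin.
(* For zero deficit nothing can absorb the error [s]: take a limit. *)
have [r0|r0] := ltrP 0 rho.
  have [I [J [hI hJ]]] := appr rho r0.
  exists I, J; split; [apply: le_trans hI _|apply: le_trans hJ _]; rewrite lee_fin; nra.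
have rhoE : rho = 0 by apply/eqP; rewrite eq_le r0 rho0.
rewrite rhoE mulr0.
have [| I hI] := @interval_limit R A.
  by move=> s /appr [I [J [hI _]]]; exists I; move: hI; rewrite rhoE !mulr0 add0r.
have [| J hJ] := @interval_limit R B.
  by move=> s /appr [I' [J [_ hJ]]]; exists J; move: hJ; rewrite rhoE !mulr0 add0r.
by exists I, J.
Qed.
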